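(* Let $(X,T)$ be a $\mathbb{Z}^2$-topological dynamical system, $\mu\in M(X,T)$, $\vec v=(1,\beta)\in\mathbb{R}^2$ a direction vector with $\beta$ irrational, and let $(\widetilde X,\widetilde{\mathcal B},\widetilde\mu,\Theta)$ be the associated skew product system. Then $$\mathcal{C}\times\mathcal{P}_\mu^{\vec v}=\mathcal{P}_{\widetilde\mu}$$ (as $\sigma$-algebras completed with respect to $\widetilde\mu$, i.e. modulo $\widetilde\mu$-null sets), where $\mathcal{P}_\mu^{\vec v}$ is the directional Pinsker algebra of $\mu$ along $\vec v$ and $\mathcal{P}_{\widetilde\mu}$ is the Pinsker algebra of $(\widetilde X,\widetilde{\mathcal B},\widetilde\mu,\Theta)$. Moreover, if $\mu=\int_X\mu_x\,d\mu(x)$ is the disintegration of $\mu$ over $\mathcal{P}_\mu^{\vec v}$ and $\widetilde\mu=\int_{\widetilde X}\widetilde\mu_{(t,x)}\,d\widetilde\mu(t,x)$ is the disintegration of $\widetilde\mu$ over $\mathcal{P}_{\widetilde\mu}$, then $$\widetilde\mu_{(t,x)}=\delta_t\times\mu_x\quad\text{for }\widetilde\mu\text{-a.e. }(t,x)\in\widetilde X.$$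
   Context: A $\mathbb{Z}^2$-topological dynamical system $(X,T)$ is a compact metric space $(X,d)$ with homeomorphisms $T^{\vec w}$, $\vec w\in\mathbb{Z}^2$, such that $T^{\vec w}\circ T^{\vec u}=T^{\vec w+\vec u}$ and $T^{\vec 0}=\mathrm{id}$. $\mathcal{B}_X$ is the Borel $\sigma$-algebra; $M(X,T)$ is the set of Borel probability measures invariant under all $T^{\vec w}$. $\mathcal{P}_X$ is the set of finite Borel partitions of $X$, and $H_\mu(\alpha)=-\sum_{A\in\alpha}\mu(A)\log\mu(A)$. Directional entropy: for $b>0$ let $\Lambda^{\vec v}(b)=\{(m,n)\in\mathbb{Z}^2:\beta m-b\le n\le\beta m+b\}$ and $\Lambda_N^{\vec v}(b)=\Lambda^{\vec v}(b)\cap([0,N-1]\times\mathbb{Z})$. For $\alpha\in\mathcal{P}_X$, $$h_\mu^{\vec v}(T,\alpha)=\sup_{b>0}\limsup_{N\to\infty}\frac1N H_\mu\Big(\bigvee_{(m,n)\in\Lambda_N^{\vec v}(b)}T^{-(m,n)}\alpha\Big).$$ Directional Pinsker algebra: $\mathcal{P}_\mu^{\vec v}=\{A\in\mathcal{B}_X:h_\mu^{\vec v}(T,\{A,A^c\})=0\}$. Skew product: $\Omega=[0,1)$ is the one-dimensional torus with Borel $\sigma$-algebra $\mathcal{C}$ and Lebesgue measure $m$; $R_\beta t=t+\beta\pmod 1$. Put $\widetilde X=\Omega\times X$, $\widetilde{\mathcal B}=\mathcal{C}\times\mathcal{B}_X$ (product $\sigma$-algebra), $\widetilde\mu=m\times\mu$,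 and $\Theta(t,x)=(R_\beta t,T^{(1,[\beta+t])}x)$, where $[a]$ is the largest integer $\le a$. The Pinsker algebra is $\mathcal{P}_{\widetilde\mu}=\{A\in\widetilde{\mathcal B}:h_{\widetilde\mu}(\Theta,\{A,A^c\})=0\}$, with $h_{\widetilde\mu}(\Theta,\cdot)$ the usual entropy of a partition. Sub-$\sigma$-algebras are always taken completed under the measure. The disintegration of $\mu$ over a sub-$\sigma$-algebra $\mathcal{F}$ is the ($\mu$-a.e. unique) measurable map $x\mapsto\mu_x\in M(X)$ (Borel probability measures) with $\mathbb{E}_\mu(f|\mathcal{F})(x)=\int f\,d\mu_x$ for $\mu$-a.e. $x$, for every $f\in L^1(\mu)$; similarly for $\widetilde\mu$ on $\widetilde X$. $\delta_t$ is the Dirac measure at $t$. *)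

(* Defs.v *)
From HB Require Import structures.
From mathcomp Require Import all_boot all_order all_algebra.
From mathcomp Require Import all_classical all_reals all_analysis.
Import Order.TTheory GRing.Theory Num.Theory.
Import numFieldNormedType.Exports.

Set Implicit Arguments.
Unset Strict Implicit.
Unset Printing Implicit Defensive.

Local Open Scope classical_set_scope.
Local Open Scope ring_scope.

(* The library's measurable types are pointed, so a metric space needs a point
   to carry its Borel sigma-algebra.  A space with a probability measure is
   nonempty, so this is no restriction. *)
#[short(type="pmetricType")]
HB.structure Definition PointedMetric (K : numDomainType) :=
  {M of Metric K M & Pointed M}.

Definition borel (X : ptopologicalType) : measurableType (@open X).-sigma :=
  g_sigma_algebraType (@open X).

(* Each [T w] is a homeomorphism, its inverse being [T (- w)]. *)
Definition Z2_action (X : topologicalType) (T : int * int -> X -> X) :=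
  [/\ forall w, continuous (T w),
      T 0 = id &
      forall w u, T w \o T u = T (w + u)].

Definition invariant_measure (R : realType) d (X : measurableType d)
    (T : int * int -> X -> X) (mu : set X -> \bar R) :=
  forall w A, measurable A -> mu (T w @^-1` A) = mu A.

Section completion.
Context {R : realType} {d} {X : measurableType d}.
Variables (mu : {measure set X -> \bar R}) (F : set (set X)).

(* The null sets are those of [mu] on the whole sigma-algebra of [X], not those
   of its restriction to [F]; hence the symmetric difference, where
   [completed_algebra_gen] can do with a union. *)
Definition completion : set (set X) :=
  [set A | exists2 B, F B & mu.-negligible (A `+` B)].

(* [g] is a version of the conditional expectation of [f] given the completion
   of [F], where [F] consists of measurable sets. *)
Definition cond_exp_version (f g : X -> R) :=
  [/\ mu.-integrable setT (EFin \o g),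
      forall Y, measurable Y -> completion (g @^-1` Y) &
      forall A, F A ->
        (\int[mu]_(x in A) (g x)%:E = \int[mu]_(x in A) (f x)%:E)%E].

(* [pprobability X R] is the space of probability measures on [X] with the
   sigma-algebra generated by the evaluations [nu |-> nu A]. *)
Definition disintegration (mu_ : X -> pprobability X R) :=
  (forall Y : set (pprobability X R),
     measurable Y -> completion (mu_ @^-1` Y)) /\
  (forall f : X -> R, mu.-integrable setT (EFin \o f) ->
     exists2 g, cond_exp_version f g &
       {ae mu, forall x, (g x)%:E = (\int[mu_ x]_y (f y)%:E)%E}).

End completion.

Section entropy.
Context {R : realType} {X : Type}.

(* Finite partitions are sets of sets.  A join may contain the empty set, which
   does not contribute to the entropy: [0 * ln 0 = 0]. *)
Definition join_partitions (I : Type) (D : set I) (alpha : I -> set (set X)) :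
    set (set X) :=
  [set \bigcap_(i in D) c i |
     c in [set c : I -> set X | forall i, D i -> alpha i (c i)]].

Definition static_entropy (mu : set X -> \bar R) (alpha : set (set X)) : R :=
  - \sum_(A \in alpha) (fine (mu A) * ln (fine (mu A))).

Definition KS_entropy (mu : set X -> \bar R) (f : X -> X)
    (alpha : set (set X)) : \bar R :=
  limn (fun N : nat =>
    (N%:R^-1 * static_entropy mu
       (join_partitions [set n : nat | (n < N)%N]
          (fun n => preimage_set_system setT (iter n f) alpha)))%:E).

Definition strip (beta b : R) : set (int * int) :=
  [set w | beta * w.1%:~R - b <= w.2%:~R <= beta * w.1%:~R + b].

Definition strip_window (beta b : R) (N : nat) : set (int * int) :=
  strip beta b `&` [set w | 0 <= w.1 <= N%:Z - 1].

Definition directional_entropy (mu : set X -> \bar R)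
    (T : int * int -> X -> X) (beta : R) (alpha : set (set X)) : \bar R :=
  ereal_sup [set limn_esup (fun N : nat =>
    (N%:R^-1 * static_entropy mu
       (join_partitions (strip_window beta b N)
          (fun w => preimage_set_system setT (T w) alpha)))%:E)
    | b in [set b : R | 0 < b]].

End entropy.

Definition directional_Pinsker (R : realType) d (X : measurableType d)
    (mu : set X -> \bar R) (T : int * int -> X -> X) (beta : R) :
    set (set X) :=
  [set A | measurable A /\
           directional_entropy mu T beta [set A; ~` A] = 0%E].

Definition Pinsker (R : realType) d (X : measurableType d)
    (mu : set X -> \bar R) (f : X -> X) : set (set X) :=
  [set A | measurable A /\ KS_entropy mu f [set A; ~` A] = 0%E].

Definition product_sigma_algebra (X Y : Type) (F : set (set X))
    (G : set (set Y)) : set (set (X * Y)) :=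
  <<s [set A `*` B | A in F & B in G] >>.

Section torus.
Variable R : realType.

Record torus := Torus { torus_val : R; torus_valP : 0 <= torus_val < 1 }.

HB.instance Definition _ := [isSub for torus_val].
HB.instance Definition _ := [Choice of torus by <:].

Lemma frac_subproof (t : R) : 0 <= t - (Num.floor t)%:~R < 1.
Proof.
rewrite subr_ge0 ltrBlDl.
have /andP[-> h] := floor_itv t.
by move: h; rewrite intrD.
Qed.

Definition frac (t : R) : torus := Torus (frac_subproof t).

HB.instance Definition _ := isPointed.Build torus (frac 0).
HB.instance Definition _ :=
  Measurable.copy torus (g_sigma_algebra_preimageType torus_val).

Definition rotation (beta : R) (t : torus) : torus := frac (torus_val t + beta).

(* Lebesgue measure on [0, 1[ *)
Definition torus_measure (A : set torus) : \bar R :=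
  lebesgue_measure (torus_val @` A).

Lemma measurable_torus_val_image (A : set torus) :
  measurable A -> measurable (torus_val @` A).
Proof.
move=> [B mB] <-; rewrite setTI.
rewrite (_ : _ @` _ = B `&` `[0, 1[); first exact: measurableI.
apply/seteqP; split => [_ [t Bt <-]|t [Bt t01]].
  by split => //=; rewrite in_itv/= torus_valP.
by move: t01; rewrite /= in_itv/= => t01; exists (Torus t01).
Qed.

Lemma torus_val_inj : injective torus_val.
Proof. exact: val_inj. Qed.

Let torus_measure0 : torus_measure set0 = 0%E.
Proof. by rewrite /torus_measure image_set0 measure0. Qed.

Let torus_measure_ge0 (A : set torus) : (0 <= torus_measure A)%E.
Proof. exact: measure_ge0. Qed.

Let torus_measure_sigma_additive : semi_sigma_additive torus_measure.
Proof.
move=> F mF tF mUF; rewrite /torus_measure image_bigcup.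
apply: measure_semi_sigma_additive.
- by move=> i; exact: measurable_torus_val_image.
- move=> i j _ _ [_ [[t Fit <-] [u Fju]]] /torus_val_inj ut.
  by apply: tF => //; exists t; split=> //; rewrite -ut.
- by rewrite -image_bigcup; exact: measurable_torus_val_image.
Qed.

HB.instance Definition _ := isMeasure.Build _ _ _ torus_measure
  torus_measure0 torus_measure_ge0 torus_measure_sigma_additive.

Let torus_measure_setT : torus_measure setT = 1%E.
Proof.
rewrite /torus_measure (_ : _ @` _ = `[0, 1[%classic).
  by rewrite lebesgue_measure_itv/= lte01 oppr0 adde0.
apply/seteqP; split => [_ [t _ <-]|t].
  by rewrite /= in_itv/= torus_valP.
by rewrite /= in_itv/= => t01; exists (Torus t01).
Qed.

HB.instance Definition _ :=
  Measure_isProbability.Build _ _ _ torus_measure torus_measure_setT.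

End torus.

Definition skew_product (R : realType) (X : Type) (T : int * int -> X -> X)
    (beta : R) (z : torus R * X) : torus R * X :=
  (rotation beta z.1, T (1, Num.floor (beta + torus_val z.1)) z.2).

(* Main.v *)
(* The itinerary of the skew product [Theta] over a base point [t] is read along
   the lattice points [(n, floor (n beta + t))].  For [n < N] this path takes at
   most [N + 1] shapes as [t] varies, and every strip along [(1, beta)] is covered
   by finitely many vertical translates of it.  Hence a set [A] is in
   the directional Pinsker algebra iff the cylinder over [A] has zero entropy
   under [Theta].
   The maps [S_u (t, x) = (t + u mod 1, T^(0, [t + u]) x)] commute with [Theta] and
   preserve the product measure, so they preserve its Pinsker algebra, which also
   contains all [C * X] since rotations have zero entropy.  Cutting the torus into
   [n] arcs and translating each of them by some [S_u] turns a set [E] of the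
   Pinsker algebra into one whose sections are all close to a given section [E_t].
   Since [S_u] is continuous at [u = 0] in measure, the cylinder over [E_t] has
   zero entropy for almost every [t], so almost all sections of [E] are in the
   directional Pinsker algebra, and [E] is approximated by step sets made of such
   sections.
   The disintegrations then agree on a countable pi-system of rectangles, by
   uniqueness of conditional expectations. *)
Require Import Defs.
From mathcomp Require Import all_boot all_order all_algebra.
From mathcomp Require Import all_classical all_reals all_analysis.
From mathcomp Require Import measurable_realfun ring lra zify.
Import Order.TTheory GRing.Theory Num.Theory.
Import numFieldNormedType.Exports.

Set Implicit Arguments.
Unset Strict Implicit.
Unset Printing Implicit Defensive.

Local Open Scope classical_set_scope.
Local Open Scope ring_scope.

(** * Finite labels and their entropy *)

(** Zero entropy of a set means that the unnormalised entropy of its [N]-step itinerary is [o(N)].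
    All bounds are upper bounds, obtained by exhibiting one itinerary as a function of others; they
    rest on subadditivity and on monotonicity under relabelling. They survive limits in measure
    because the itinerary of a small set costs little per step. [Theta] and the maps [S_u] belong to
    one action of the group [Z x R], induced from the action [T] of [Z x Z]: its space is the
    quotient of [R x X] identifying [(r, x)] with [(r - 1, T (0, 1) x)], cut open along [r = 0]. The
    group is abelian, hence the commutation. The obstacle is that a single section of [E] lies over
    a null set, so closeness in measure to [E] says nothing about it. The flow [S_u] compares a
    section with its neighbours, and Fubini over two copies of the torus (base point and position)
    makes the comparison small for almost every base point. Continuity of the flow only has to be
    checked on cylinders over either factor, where the error comes from short arcs. *)

Lemma sigma_algebra_setI (T : Type) (S : set (set T)) A B : sigma_algebra setT S ->
  S A -> S B -> S (A `&` B).
Proof.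
move=> [S0 SC SU] SA SB; rewrite -(setCK (A `&` B)) setCI -setTD; apply: (SC).
by rewrite -bigcup2E; apply: SU => -[|[|n]] //=; rewrite -setTD; exact: SC.
Qed.

Lemma sigma_algebra_countable_bigcup (T : Type) (S : set (set T)) (I : countType)
    (F : I -> set T) : sigma_algebra setT S -> (forall i, S (F i)) -> S (\bigcup_i F i).
Proof.
move=> [S0 SC SU] SF.
rewrite (_ : \bigcup_i F i = \bigcup_k (if unpickle k is Some i then F i else set0)).
  by apply: SU => k; case: unpickle.
apply/seteqP; split => [x [i _ Fx]|x [k _]].
  by exists (pickle i); rewrite ?pickleK.
by case: unpickle => // i Fx; exists i.
Qed.

Lemma fsbig_finType (S : Type) (idx : S) (op : Monoid.com_law idx) (I : finType)
    (F : I -> S) :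
  \big[op/idx]_(i \in [set: I]) F i = \big[op/idx]_i F i.
Proof.
rewrite [RHS]fsbig_seq ?index_enum_uniq//; apply: eq_fsbigl.
by apply/seteqP; split => // i _ /=; rewrite mem_index_enum.
Qed.

Section real_probability.
Context {R : realType} {d} {Z : measurableType d} (P : probability Z R).
Implicit Types A B C : set Z.

Definition pr A : R := fine (P A).

Lemma prE A : measurable A -> P A = (pr A)%:E.
Proof. by move=> mA; rewrite fineK// fin_num_measure. Qed.

Lemma pr_ge0 A : 0 <= pr A.
Proof. by rewrite fine_ge0. Qed.

Lemma pr_le A B : measurable A -> measurable B -> A `<=` B -> pr A <= pr B.
Proof.
by move=> mA mB AB; rewrite -lee_fin -!prE//; apply: le_measure; rewrite ?inE.
Qed.

Lemma pr_le1 A : measurable A -> pr A <= 1.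
Proof. by move=> mA; rewrite -lee_fin -prE//; exact: probability_le1. Qed.

Lemma pr0 : pr set0 = 0.
Proof. by rewrite /pr measure0. Qed.

Lemma prT : pr setT = 1.
Proof. by rewrite /pr probability_setT. Qed.

Lemma prU A B : measurable A -> measurable B -> A `&` B = set0 ->
  pr (A `|` B) = pr A + pr B.
Proof.
move=> mA mB AB; apply: EFin_inj.
by rewrite EFinD -!prE//; [exact: measureU|exact: measurableU].
Qed.

Lemma prU_le A B : measurable A -> measurable B -> pr (A `|` B) <= pr A + pr B.
Proof.
move=> mA mB; rewrite -lee_fin EFinD -!prE//; last exact: measurableU.
exact: measureU2.
Qed.

Lemma prC A : measurable A -> pr (~` A) = 1 - pr A.
Proof.
move=> mA; rewrite -prT -(setUv A) prU ?setICr//; last exact: measurableC.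
by rewrite addrAC subrr add0r.
Qed.

(** A finite measurable partition is encoded by its label map: joins become pairs or finite
    functions of labels, coarsening becomes composition, and empty cells do no harm. *)
Definition measurable_label (I : finType) (xi : Z -> I) :=
  forall i, measurable (xi @^-1` [set i]).

Lemma measurable_label_preimage (I : finType) (xi : Z -> I) (S : set I) :
  measurable_label xi -> measurable (xi @^-1` S).
Proof.
move=> mxi; rewrite (_ : _ @^-1` _ = \bigcup_(i in S) (xi @^-1` [set i])).
  by apply: fin_bigcup_measurable => //; exact: finite_finset.
by apply/seteqP; split => [z Sz|z [i Si /= ->]//]; exists (xi z).
Qed.

Lemma measurable_label_comp (I J : finType) (xi : Z -> I) (phi : I -> J) :
  measurable_label xi -> measurable_label (phi \o xi).
Proof. by move=> mxi j; exact: (measurable_label_preimage (phi @^-1` [set j])). Qed.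

Lemma measurable_label_pair (I J : finType) (xi : Z -> I) (zeta : Z -> J) :
  measurable_label xi -> measurable_label zeta ->
  measurable_label (fun z => (xi z, zeta z)).
Proof.
move=> mxi mzeta [i j].
rewrite (_ : _ @^-1` _ = xi @^-1` [set i] `&` zeta @^-1` [set j]).
  exact: measurableI.
by apply/seteqP; split => [z [<- <-]|z [/= -> ->]].
Qed.

Lemma measurable_label_ffun (I J : finType) (xi : I -> Z -> J) :
  (forall i, measurable_label (xi i)) ->
  measurable_label (fun z => [ffun i => xi i z]).
Proof.
move=> mxi g.
rewrite (_ : _ @^-1` _ = \bigcap_(i in setT) (xi i @^-1` [set g i])).
  by apply: fin_bigcap_measurable => [|i _]; [exact: finite_finset|exact: mxi].
apply/seteqP; split => [z /= gE i _ /=|z gE /=].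
  by rewrite -gE ffunE.
by apply/ffunP => i; rewrite ffunE; exact: gE.
Qed.

Lemma measurable_label_set A : measurable A -> measurable_label (fun z => `[<A z>]).
Proof.
move=> mA [].
  by rewrite (_ : _ @^-1` _ = A)//; apply/seteqP; split => z /asboolP.
rewrite (_ : _ @^-1` _ = ~` A); first exact: measurableC.
apply/seteqP; split => z /=; last exact: asboolF.
by move=> + Az; rewrite asboolT.
Qed.

Lemma pr_label_sum (I : finType) (xi : Z -> I) B :
  measurable_label xi -> measurable B ->
  \sum_i pr (B `&` xi @^-1` [set i]) = pr B.
Proof.
move=> mxi mB; apply: EFin_inj; rewrite -prE// -sumEFin.
transitivity (\sum_(i \in [set: I]) P (B `&` xi @^-1` [set i]))%E.
  by rewrite fsbig_finType; apply: eq_bigr => i _; rewrite prE//; exact: measurableI.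
rewrite -measure_fin_bigcup/=; last 3 first.
- exact: finite_finset.
- by move=> i j _ _ [z [[_ <-] [_ <-]]].
- by move=> i _; exact: measurableI.
congr (P _); rewrite -setI_bigcupr; apply/seteqP; split => [z []//|z Bz].
by split => //; exists (xi z).
Qed.

Lemma pr_label1 (I : finType) (xi : Z -> I) :
  measurable_label xi -> \sum_i pr (xi @^-1` [set i]) = 1.
Proof.
move=> mxi; rewrite -prT -(pr_label_sum mxi measurableT).
by apply: eq_bigr => i _; rewrite setTI.
Qed.

(** Transfer formula for expectations; it rewrites marginal entropies as sums over the cells of a
    joint label. *)
Lemma pr_label_comp (I J : finType) (xi : Z -> I) (phi : I -> J) (c : J -> R) :
  measurable_label xi ->
  \sum_j pr ((phi \o xi) @^-1` [set j]) * c j =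
  \sum_i pr (xi @^-1` [set i]) * c (phi i).
Proof.
move=> mxi; rewrite [RHS](partition_big phi xpredT)//=; apply: eq_bigr => j _.
rewrite -(pr_label_sum mxi)/=; last exact: (measurable_label_comp phi mxi).
rewrite mulr_suml big_mkcond [RHS]big_mkcond; apply: eq_bigr => i _ /=.
case: eqVneq => [<-|pij].
  by congr (pr _ * _); apply/seteqP; split => [z []//|z /= ->].
rewrite (_ : _ `&` _ = set0) ?pr0 ?mul0r//; apply/seteqP; split => // z /= [zj zi].
by move: pij; rewrite -zj -zi eqxx.
Qed.

End real_probability.

(** * Gibbs' inequality *)

Section gibbs.
Context {R : realType}.

Lemma ln_prod (I : finType) (f : I -> R) :
  (forall i, 0 < f i) -> ln (\prod_i f i) = \sum_i ln (f i).
Proof.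
move=> f0; suff: 0 < \prod_i f i /\ ln (\prod_i f i) = \sum_i ln (f i) by case.
elim/big_ind2 : _ => [|x a y b [x0 xa] [y0 yb]|i _]; rewrite ?ln1//.
by split; rewrite ?mulr_gt0// lnM ?posrE// xa yb.
Qed.

(** Termwise [ln x <= x - 1] at [x = q i / p i]. Positivity of [q] where [p] is positive is an
    explicit hypothesis because [ln 0] is 0 here, not minus infinity. *)
Lemma gibbs_inequality (I : finType) (p q : I -> R) :
  (forall i, 0 <= p i) -> (forall i, 0 <= q i) ->
  (forall i, 0 < p i -> 0 < q i) -> \sum_i q i <= \sum_i p i ->
  - \sum_i p i * ln (p i) <= - \sum_i p i * ln (q i).
Proof.
move=> p0 q0 pq qp; rewrite lerN2 -subr_le0 -sumrB.
rewrite (le_trans _ (_ : \sum_i (q i - p i) <= 0))//; last by rewrite sumrB subr_le0.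
apply: ler_sum => i _; have [pi0|pi0|pi0] := ltgtP 0 (p i).
- have qi0 := pq _ pi0.
  rewrite -mulrBr -ln_div ?posrE//.
  rewrite (_ : q i - p i = p i * (q i / p i - 1)); last first.
    by rewrite mulrBr mulr1 mulrCA divff ?mulr1// gt_eqF.
  rewrite ler_pM2l//.
  have := @le_ln1Dx R (q i / p i - 1); rewrite addrCA subrr addr0; apply.
  by rewrite ltrBrDr addrC subrr divr_gt0.
- by have := p0 i; rewrite leNgt pi0.
- by rewrite -pi0 !mul0r subrr subr0.
Qed.

End gibbs.

Section label_entropy.
Context {R : realType} {d} {Z : measurableType d} (P : probability Z R).

Definition label_entropy (I : finType) (xi : Z -> I) : R :=
  - \sum_i pr P (xi @^-1` [set i]) * ln (pr P (xi @^-1` [set i])).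

Lemma label_entropy_ge0 (I : finType) (xi : Z -> I) :
  measurable_label xi -> 0 <= label_entropy xi.
Proof.
move=> mxi; rewrite /label_entropy oppr_ge0; apply: sumr_le0 => i _.
by rewrite mulr_ge0_le0 ?pr_ge0// ln_le0// pr_le1.
Qed.

Lemma label_entropy_comp (I J : finType) (xi : Z -> I) (phi : I -> J) :
  measurable_label xi -> label_entropy (phi \o xi) <= label_entropy xi.
Proof.
move=> mxi; rewrite /label_entropy lerN2.
rewrite (pr_label_comp P phi (fun j => ln (pr P ((phi \o xi) @^-1` [set j]))) mxi).
apply: ler_sum => i _.
have [->|pi0] := eqVneq (pr P (xi @^-1` [set i])) 0; first by rewrite !mul0r.
rewrite ler_wpM2l ?pr_ge0//.
have ple : pr P (xi @^-1` [set i]) <= pr P ((phi \o xi) @^-1` [set phi i]).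
  apply: pr_le => //; first exact: (measurable_label_comp phi mxi).
  by move=> z /= ->.
have pgt : 0 < pr P (xi @^-1` [set i]) by rewrite lt_neqAle eq_sym pi0 pr_ge0.
by rewrite ler_ln ?posrE// (lt_le_trans pgt).
Qed.

(** Each of the next upper bounds is a choice of reference weights [q]: products of the marginals
    for joint labels, the uniform weight for the bound by the number of labels. *)
Lemma label_entropy_cross (I : finType) (xi : Z -> I) (q : I -> R) :
  measurable_label xi -> (forall i, 0 <= q i) ->
  (forall i, 0 < pr P (xi @^-1` [set i]) -> 0 < q i) -> \sum_i q i <= 1 ->
  label_entropy xi <= - \sum_i pr P (xi @^-1` [set i]) * ln (q i).
Proof.
move=> mxi q0 pq q1; apply: gibbs_inequality => //.
  by move=> i; exact: pr_ge0.
by rewrite (pr_label1 P mxi).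
Qed.

Lemma label_entropy_pair (I J : finType) (xi : Z -> I) (zeta : Z -> J) :
  measurable_label xi -> measurable_label zeta ->
  label_entropy (fun z => (xi z, zeta z)) <=
  label_entropy xi + label_entropy zeta.
Proof.
move=> mxi mzeta; set w := fun z => _.
have mw : measurable_label w by exact: measurable_label_pair.
pose q (k : I * J) := pr P (xi @^-1` [set k.1]) * pr P (zeta @^-1` [set k.2]).
have pos k : 0 < pr P (w @^-1` [set k]) ->
    0 < pr P (xi @^-1` [set k.1]) /\ 0 < pr P (zeta @^-1` [set k.2]).
  move=> pk; split; apply: (lt_le_trans pk); apply: pr_le => //;
  by move=> z /= <-.
apply: (@le_trans _ _ (- \sum_k pr P (w @^-1` [set k]) * ln (q k))).
  apply: label_entropy_cross => //.
  - by move=> k; rewrite mulr_ge0 ?pr_ge0.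
  - by move=> k /pos[? ?]; rewrite mulr_gt0.
  rewrite -(pair_bigA_idem _ (fun i j => pr P (xi @^-1` [set i]) * pr P (zeta @^-1` [set j])))/= ?addr0//.
  under eq_bigr => i _ do rewrite -mulr_sumr (pr_label1 P mzeta) mulr1.
  by rewrite (pr_label1 P mxi).
rewrite /label_entropy -opprD lerN2.
rewrite (pr_label_comp P (fst : I * J -> I) (fun i => ln (pr P (xi @^-1` [set i]))) mw).
rewrite (pr_label_comp P (snd : I * J -> J) (fun i => ln (pr P (zeta @^-1` [set i]))) mw).
rewrite -big_split/=; apply: ler_sum => k _; rewrite -mulrDr.
have [->|pk] := eqVneq (pr P (w @^-1` [set k])) 0; first by rewrite !mul0r.
have /pos[? ?] : 0 < pr P (w @^-1` [set k]) by rewrite lt_neqAle eq_sym pk pr_ge0.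
by rewrite lnM ?posrE.
Qed.

Lemma label_entropy_ffun (I J : finType) (xi : I -> Z -> J) :
  (forall i, measurable_label (xi i)) ->
  label_entropy (fun z => [ffun i => xi i z]) <= \sum_i label_entropy (xi i).
Proof.
move=> mxi; set w := fun z => _.
have mw : measurable_label w by exact: measurable_label_ffun.
pose q (g : {ffun I -> J}) := \prod_i pr P (xi i @^-1` [set g i]).
have pos g : 0 < pr P (w @^-1` [set g]) ->
    forall i, 0 < pr P (xi i @^-1` [set g i]).
  move=> pg i; apply: (lt_le_trans pg); apply: pr_le => //; first exact: mxi.
  by move=> z /= <-; rewrite ffunE.
apply: (@le_trans _ _ (- \sum_g pr P (w @^-1` [set g]) * ln (q g))).
  apply: label_entropy_cross => //.
  - by move=> g; apply: prodr_ge0 => i _; exact: pr_ge0.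
  - by move=> g /pos pg; apply: prodr_gt0 => i _; exact: pg.
  rewrite -(bigA_distr_bigA (fun i j => pr P (xi i @^-1` [set j]))).
  by rewrite big1// => i _; exact: pr_label1.
rewrite /label_entropy sumrN lerN2.
rewrite (eq_bigr (fun i => \sum_g pr P (w @^-1` [set g]) *
    ln (pr P (xi i @^-1` [set g i])))); last first.
  move=> i _; rewrite -(pr_label_comp P (fun g : {ffun I -> J} => g i)
    (fun j => ln (pr P (xi i @^-1` [set j]))) mw).
  apply: eq_bigr => j _; congr (pr P _ * _).
  by apply/seteqP; split => z /=; rewrite ffunE.
rewrite exchange_big/=; apply: ler_sum => g _; rewrite -mulr_sumr.
have [->|pg] := eqVneq (pr P (w @^-1` [set g])) 0; first by rewrite !mul0r.
have {}pg : 0 < pr P (w @^-1` [set g]) by rewrite lt_neqAle eq_sym pg pr_ge0.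
rewrite ler_wpM2l ?(ltW pg)//.
by rewrite ln_prod//; exact: pos.
Qed.

Lemma label_entropy_le_ln_card (I : finType) (xi : Z -> I) :
  measurable_label xi -> label_entropy xi <= ln #|I|%:R.
Proof.
move=> mxi; have I0 : (0 < #|I|)%N by apply/card_gt0P; exists (xi point).
apply: (le_trans (label_entropy_cross (q := fun=> #|I|%:R^-1) mxi _ _ _)).
- by move=> i; rewrite invr_ge0.
- by move=> i _; rewrite invr_gt0 ltr0n.
- by rewrite sumr_const -[leLHS]mulr_natr mulVf// pnatr_eq0 -lt0n.
- rewrite -mulr_suml (pr_label1 P mxi) mul1r lnV ?opprK//.
  by rewrite posrE ltr0n.
Qed.

(* The thresholds are linearly ordered, so the label is determined by how many
   of them exceed [tau z]. *)
Lemma label_entropy_thresholds (I : finType) (xi : Z -> {ffun I -> bool})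
    (tau : Z -> R) (theta : I -> R) :
  measurable_label xi -> (forall z i, xi z i = (tau z < theta i)) ->
  label_entropy xi <= ln #|I|.+1%:R.
Proof.
move=> mxi xiE.
have cle (g : {ffun I -> bool}) : (#|[set i | g i]%SET| < #|I|.+1)%N.
  by rewrite ltnS; exact: max_card.
pose psi (g : {ffun I -> bool}) := Ordinal (cle g).
(* [phi k] is the label of some point with [k] true entries; the default [point] is used only for a
   count that no point attains. *)
pose phi (k : 'I_#|I|.+1) := xi (xget point [set z | psi (xi z) = k]).
(* The sets of true entries form a chain, so equal cardinality forces equality. *)
have mono z z' : tau z' <= tau z -> [set i | xi z i]%SET \subset [set i | xi z' i]%SET.
  move=> tz; apply/fintype.subsetP => i; rewrite !inE !xiE.
  exact: le_lt_trans.
have det z z' : psi (xi z) = psi (xi z') -> xi z = xi z'.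
  move=> /(congr1 val)/= czz'; apply/ffunP => i.
  suff /setP/(_ i) : [set i | xi z i]%SET = [set i | xi z' i]%SET by rewrite !inE.
  have [tz|/ltW tz] := leP (tau z') (tau z).
    by apply/eqP; rewrite eqEcard mono//= czz'.
  by apply/esym/eqP; rewrite eqEcard mono//= czz'.
have -> : xi = phi \o (psi \o xi).
  apply/funext => z /=; apply: det; rewrite /phi.
  by case: xgetP => [y _ /= ->//|/(_ z)/=].
rewrite (le_trans (label_entropy_comp _ (measurable_label_comp psi mxi)))//.
rewrite (le_trans (label_entropy_le_ln_card (measurable_label_comp psi mxi)))//.
by rewrite card_ord.
Qed.

End label_entropy.

Lemma label_entropy_preserving {R : realType} {d d'} {Z : measurableType d}
    {Z' : measurableType d'} (P : probability Z R) (P' : probability Z' R)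
    (f : Z' -> Z) (I : finType) (xi : Z -> I) :
  (forall A, measurable A -> P' (f @^-1` A) = P A) -> measurable_label xi ->
  label_entropy P' (xi \o f) = label_entropy P xi.
Proof.
move=> fP mxi; congr (- _); apply: eq_bigr => i _.
by rewrite /pr comp_preimage fP.
Qed.

(** * Approximation up to a small symmetric difference *)

Section approximation.
Context {R : realType} {d} {Z : measurableType d} (P : probability Z R).
Implicit Types A B C : set Z.

Lemma measurableY A B : measurable A -> measurable B -> measurable (A `+` B).
Proof. by move=> mA mB; rewrite setY_def; apply: measurableU; exact: measurableD. Qed.

Lemma setY_triangle A B C : A `+` C `<=` (A `+` B) `|` (B `+` C).
Proof. by move=> z; rewrite /setY/setU/setD/=; have [] := pselect (B z); tauto. Qed.

Lemma setYUU A A' B B' : (A `|` A') `+` (B `|` B') `<=` (A `+` B) `|` (A' `+` B').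
Proof. by move=> z; rewrite /setY/setU/setD/=; tauto. Qed.

Lemma setYCC A B : ~` A `+` ~` B = A `+` B.
Proof.
apply/seteqP; split => z; rewrite /setY/setU/setD/setC/=; last tauto.
by move=> [[Az /contrapT Bz]|[Bz /contrapT Az]]; [right|left].
Qed.

Lemma prY_triangle B A C : measurable A -> measurable B -> measurable C ->
  pr P (A `+` C) <= pr P (A `+` B) + pr P (B `+` C).
Proof.
move=> mA mB mC; have mAB := measurableY mA mB; have mBC := measurableY mB mC.
apply: le_trans (prU_le P mAB mBC); apply: pr_le; [exact: measurableY| |exact: setY_triangle].
exact: measurableU.
Qed.

(** A countable union is the limit in measure of its partial unions, so for an algebra of sets
    closedness in measure yields countable unions. *)
Lemma sigma_algebra_approx (K : set (set Z)) :
  K `<=` measurable -> K set0 -> (forall A, K A -> K (~` A)) ->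
  (forall A B, K A -> K B -> K (A `|` B)) ->
  (forall A, measurable A ->
    (forall e, 0 < e -> exists2 B, K B & pr P (A `+` B) <= e) -> K A) ->
  sigma_algebra setT K.
Proof.
move=> mK K0 KC KU Kapprox; split => //.
  by move=> A KA; rewrite setTD; exact: KC.
move=> F zF; have mF n : measurable (F n) by exact: mK.
have mUF : measurable (\bigcup_n F n) by exact: bigcupT_measurable.
apply: Kapprox => // e e0.
pose G n := \big[setU/set0]_(i < n) F i.
have zG n : K (G n).
  by rewrite /G; elim/big_ind : _.
have mG n : measurable (G n) by exact: mK.
have : P (G n) @[n --> \oo] --> P (\bigcup_n F n).
  rewrite -bigcup_bigsetU_bigcup -(cvg_shiftS (P \o G)).
  apply: nondecreasing_cvg_mu => [n||m n mn] /=; first exact: mG.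
  - by apply: bigcupT_measurable => n; exact: mG.
  - by apply/subsetPset; apply: subset_bigsetU.
rewrite (prE P mUF) => /fine_cvg/cvgrPdist_le/(_ _ e0)[n _ /(_ n (leqnn n))/= Gn].
exists (G n) => //; have sGF : G n `<=` \bigcup_n F n.
  by rewrite /G -bigcup_mkord => x [i _ Fx]; exists i.
have -> : (\bigcup_n F n) `+` G n = (\bigcup_n F n) `\` G n.
  by rewrite setY_def (_ : G n `\` _ = set0) ?setU0// setD_eq0.
have : pr P (\bigcup_n F n) = pr P (G n) + pr P ((\bigcup_n F n) `\` G n).
  by rewrite -prU ?setDUK ?setDIK//; exact: measurableD.
have := le_trans (ler_norm _) Gn; rewrite -/(pr P _) -/(pr P _).
lra.
Qed.

(** An algebra containing a generator is dense: the sets that it approximates satisfy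
    [sigma_algebra_approx]. *)
Lemma measurable_approx (K G : set (set Z)) :
  measurable = <<s G >> -> G `<=` K -> K `<=` measurable ->
  K set0 -> (forall A, K A -> K (~` A)) -> (forall A B, K A -> K B -> K (A `|` B)) ->
  forall E e, measurable E -> 0 < e -> exists2 B, K B & pr P (E `+` B) <= e.
Proof.
move=> mG GK mK K0 KC KU E e mE; move: e.
pose K' := [set A | measurable A /\ forall e, 0 < e -> exists2 B, K B & pr P (A `+` B) <= e].
suff : K' E by case.
have KK' : K `<=` K'.
  by move=> A KA; split => [|e e0]; [exact: mK|exists A; rewrite ?setYK ?pr0// ltW].
have : <<s G >> E by rewrite -mG.
apply: smallest_sub => [|A GA]; last exact/KK'/GK.
apply: sigma_algebra_approx => [A []//| |A [mA Ae]|A B [mA Ae] [mB Be]|A mA Ae].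
- exact: KK'.
- split; first exact: measurableC.
  by move=> e /Ae[B KB AB]; exists (~` B); rewrite ?setYCC//; exact: KC.
- split; first exact: measurableU.
  move=> e e0; have e20 : 0 < e / 2 by rewrite divr_gt0.
  have [A' KA' AA'] := Ae _ e20; have [B' KB' BB'] := Be _ e20.
  exists (A' `|` B'); first exact: KU.
  have mAA' := measurableY mA (mK _ KA'); have mBB' := measurableY mB (mK _ KB').
  rewrite (splitr e); apply: le_trans (lerD AA' BB').
  apply: le_trans (prU_le P mAA' mBB'); apply: pr_le; last exact: setYUU.
    by apply: measurableY; apply: measurableU => //; exact: mK.
  exact: measurableU.
- split=> // e e0; have e20 : 0 < e / 2 by rewrite divr_gt0.
  have [B [mB Be] AB] := Ae _ e20; have [C KC' BC] := Be _ e20.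
  exists C => //; rewrite (splitr e); apply: le_trans (lerD AB BC).
  by apply: prY_triangle => //; exact: mK.
Qed.

(* [B] is the upper limit of approximations with summable errors. *)
Lemma negligible_approx (S : set (set Z)) A : sigma_algebra setT S ->
  S `<=` measurable -> measurable A ->
  (forall e, 0 < e -> exists2 B, S B & pr P (A `+` B) <= e) ->
  exists2 B, S B & P.-negligible (A `+` B).
Proof.
move=> [S0 SC SU] mS mA SA.
have /choice[F /all_and2[SF AF]] : forall n, exists B, S B /\
    pr P (A `+` B) <= 1 / (2 ^ n.+1)%:R.
  move=> n; have [|B SB AB] := SA (1 / (2 ^ n.+1)%:R); last by exists B.
  by rewrite divr_gt0// ltr0n expn_gt0.
have SI (B : (set Z)^nat) : (forall n, S (B n)) -> S (\bigcap_n B n).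
  move=> SB; rewrite -(setCK (\bigcap_n B n)) setC_bigcap -setTD; apply: (SC).
  by apply: SU => n; rewrite -setTD; exact: SC.
exists (lim_sup_set F).
  apply: SI => n; rewrite bigcup_mkcond; apply: SU => k; case: ifPn => // _.
have mF n : measurable (F n) by exact: mS.
have mAF n : measurable (A `+` F n) by exact: measurableY.
exists (lim_sup_set (fun n => A `+` F n)); split.
- apply: bigcapT_measurable => n; rewrite bigcup_mkcond; apply: bigcupT_measurable => k.
  by case: ifPn.
- apply: lim_sup_set_cvg0 => //; apply: le_lt_trans (ltry 1).
  apply: le_trans (epsilon_trick0 xpredT (@ler01 R)).
  apply: lee_nneseries => [n _ _|n _]; [exact: measure_ge0|].
  by have := AF n; rewrite -lee_fin -(prE P (mAF n)).
(* A point of [A] outside the upper limit misses all [F k] from some [k] on; a point of the upper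
   limit outside [A] meets infinitely many [F k]. Either way it lies in infinitely many of the
   differences. *)
- move=> z; rewrite setY_def => -[[Az nF]|[Fz nA]] n _; last first.
    by have [k nk Fk] := Fz n I; exists k => //; right.
  apply: contrapT => nn; apply: nF => m _.
  exists (n + m)%N; rewrite /= ?leq_addl//; apply: contrapT => nF.
  by apply: nn; exists (n + m)%N; rewrite /= ?leq_addr//; left.
Qed.

End approximation.

(** * Sublinear sequences *)

Section sublinear.
Context {R : realType}.
Implicit Types a b : nat -> R.

(** This is [a n = o(n)] for nonnegative [a]. The additive constant replaces a clause on large [n],
    so that comparisons and sums hold for every [n], 0 included. *)
Definition sublinear a := forall e : R, 0 < e ->
  exists C, forall n, a n <= e * n%:R + C.

Lemma sublinear_le a b : (forall n, a n <= b n) -> sublinear b -> sublinear a.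
Proof.
by move=> ab sb e e0; have [C bC] := sb _ e0; exists C => n; exact: le_trans (bC n).
Qed.

Lemma sublinearD a b : sublinear a -> sublinear b -> sublinear (fun n => a n + b n).
Proof.
move=> sa sb e e0; have e20 : 0 < e / 2 by rewrite divr_gt0.
have [C aC] := sa _ e20; have [D bD] := sb _ e20; exists (C + D) => n.
by rewrite (le_trans (lerD (aC n) (bD n)))// addrACA -mulrDl -splitr.
Qed.

Lemma sublinear0 : sublinear (fun=> 0).
Proof. by move=> e e0; exists 0 => n; rewrite addr0 mulr_ge0// ltW. Qed.

Lemma sublinear_sum (I : Type) (s : seq I) (a : I -> nat -> R) :
  (forall i, sublinear (a i)) -> sublinear (fun n => \sum_(i <- s) a i n).
Proof.
move=> sa; elim: s => [|i s ih].
  by apply: sublinear_le sublinear0 => n; rewrite big_nil.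
by apply: sublinear_le (sublinearD (sa i) ih) => n; rewrite big_cons.
Qed.

(** From [1 + n <= (1 + m n) / m] and [ln (1 + m n) <= m n]; the first needs [m <= 1], hence the cap
    on [e]. *)
Lemma sublinear_ln : sublinear (fun n => ln n.+1%:R).
Proof.
move=> e e0; pose m := Num.min e 1.
have m0 : 0 < m by rewrite lt_min e0 ltr01.
have m1 : m <= 1 by rewrite ge_min lexx orbT.
have me : m <= e by rewrite ge_min lexx.
exists (ln m^-1) => n.
have pos : 0 < 1 + m * n%:R by rewrite ltr_pwDl// mulr_ge0// ltW.
apply: (@le_trans _ _ (ln ((1 + m * n%:R) * m^-1))).
  rewrite ler_ln ?posrE ?ltr0n// ?mulr_gt0 ?invr_gt0//.
  rewrite ler_pdivlMr// mulrC -natr1 mulrDr mulr1 addrC lerD2r//.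
rewrite lnM ?posrE ?invr_gt0// lerD2r.
rewrite (le_trans (le_ln1Dx _))//; first by rewrite (lt_le_trans (ltrN10 _))// mulr_ge0// ltW.
by rewrite ler_wpM2r.
Qed.

Lemma sublinearP a : (forall n, 0 <= a n) ->
  sublinear a <-> (fun n => (n%:R^-1 * a n)%:E) @ \oo --> 0%E.
Proof.
move=> a0; split=> [sa|/fine_cvg/cvgrPdist_le ca e e0].
- apply/cvg_EFin; first exact: nearW.
  apply/cvgrPdist_le => e e0; have e20 : 0 < e / 2 by rewrite divr_gt0.
  have [C aC] := sa _ e20; near=> n.
  have n0 : 0 < n%:R :> R by rewrite ltr0n; near: n; exact: nbhs_infty_gt.
  rewrite /= sub0r normrN ger0_norm ?mulr_ge0 ?invr_ge0//.
  rewrite mulrC ler_pdivrMr// (le_trans (aC n))// {2}(splitr e) mulrDl lerD2l.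
  rewrite mulrC -ler_pdivrMr//; near: n; exact: nbhs_infty_ger.
- have [m _ mP] := ca _ e0.
  (* The constant absorbs the terms up to and including [m], so that [n] is positive in the
     remaining case. *)
  exists (\sum_(i < m.+1) a i) => n; have [mn|nm] := ltnP m n; last first.
    apply: ler_wpDl; first by rewrite mulr_ge0// ltW.
    by rewrite -ltnS in nm; rewrite (bigD1 (Ordinal nm))//= lerDl sumr_ge0.
  have := mP n (ltnW mn); rewrite /= sub0r normrN ger0_norm ?mulr_ge0 ?invr_ge0//.
  rewrite mulrC ler_pdivrMr ?ltr0n ?(leq_ltn_trans _ mn)// => ae.
  by rewrite (le_trans ae)// lerDl sumr_ge0.
Unshelve. all: by end_near.
Qed.

(** Fekete's lemma. It serves to turn [limn u = 0] into genuine convergence to 0, since the value of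
    [limn] alone says nothing about a divergent sequence. *)
Lemma fekete a : (forall n, 0 <= a n) -> (forall m n, a (m + n)%N <= a m + a n) ->
  cvgn (fun n => n%:R^-1 * a n).
Proof.
move=> a0 aD; pose u n := n%:R^-1 * a n.
have u0 n : 0 <= u n by rewrite mulr_ge0 ?invr_ge0.
pose S := [set u n | n in [set n | (0 < n)%N]].
have Slb : has_inf S.
  by split; [exists (u 1%N), 1%N|exists 0 => _ [n _ <-]].
apply/cvg_ex; exists (inf S); apply/cvgrPdist_le => e e0.
have e20 : 0 < e / 2 by rewrite divr_gt0.
have [_ [m m0 <-] um] := inf_adherent e20 Slb.
(* Bounds the contribution [a (n %% m)] of the remainder in the division of [n] by [m]. *)
pose C := \sum_(i < m) a i.
have amul q r : a (q * m + r)%N <= q%:R * a m + a r.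
  elim: q => [|q ih]; first by rewrite mul0r add0r mul0n.
  rewrite mulSn -addnA (le_trans (aD _ _))// -natr1 mulrDl mul1r.
  by rewrite (addrC _ (a m)) -addrA lerD2l.
near=> n.
have n0 : (0 < n)%N by near: n; exact: nbhs_infty_gt.
have n0R : 0 < n%:R :> R by rewrite ltr0n.
have lun : inf S <= u n by apply: ge_inf => //; [exact: (proj2 Slb)|exists n].
rewrite -/(u n) distrC ger0_norm ?subr_ge0// lerBlDl.
have Cn : C / n%:R <= e / 2.
  rewrite ler_pdivrMr// mulrC -ler_pdivrMr//; near: n; exact: nbhs_infty_ger.
have un : u n <= u m + C / n%:R.
  rewrite /u mulrC ler_pdivrMr// mulrDl divfK ?gt_eqF//.
  rewrite {1}(divn_eq n m) (le_trans (amul _ _))//; apply: lerD.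
    rewrite mulrAC ler_wpM2r//.
    rewrite ler_pdivlMl ?ltr0n// -natrM ler_nat mulnC; exact: leq_trunc_div.
  by rewrite /C (bigD1 (Ordinal (ltn_pmod n m0)))//= lerDl sumr_ge0.
rewrite (le_trans un)// (splitr e) addrA; apply: lerD => //; exact: ltW.
Unshelve. all: by end_near.
Qed.

End sublinear.

(** * Itineraries and zero entropy *)

Definition itinerary (I : finType) (X Y : Type) (g : I -> X -> Y) (A : set Y) (x : X) :
  {ffun I -> bool} := [ffun i => `[<A (g i x)>]].

Section itinerary.
Context {R : realType} {d} {X : measurableType d} (P : probability X R).

(** The nonempty members of the join are exactly the nonempty fibres of the itinerary, and distinct
    labels have distinct fibres; empty members contribute 0 on both sides. Repetitions in [e] do not
    change the fibres. *)
Lemma static_entropy_join (I : finType) (W : Type) (D : set W) (e : I -> W) (Y : Type)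
    (g : W -> X -> Y) (A : set Y) : range e = D ->
  static_entropy P (join_partitions D
    (fun w => preimage_set_system setT (g w) [set A; ~` A])) =
  label_entropy P (itinerary (g \o e) A).
Proof.
move=> eD; rewrite /static_entropy /label_entropy; congr (- _).
set S := join_partitions _ _; set xi := itinerary _ _.
pose F (B : set X) : R := fine (P B) * ln (fine (P B)).
have F0 : F set0 = 0 by rewrite /F measure0 mul0r.
pose h (l : {ffun I -> bool}) := xi @^-1` [set l].
pose L := [set l | h l !=set0].
have cell x0 x : (forall w, D w -> A (g w x) <-> A (g w x0)) <-> xi x = xi x0.
  split=> [H|/ffunP H w]; last first.
    rewrite -eD => -[i _ <-]; have := H i; rewrite !ffunE/= => /asboolP.
    by case: asboolP => Ax /asboolP; case: asboolP.
  by apply/ffunP => i; rewrite !ffunE; apply/asbool_equiv_eq/H; rewrite -eD; exists i.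
transitivity (\sum_(B \in S) F B) => //.
rewrite -(fsbig_widen (h @` L) S F); last 2 first.
- move=> _ [l [x0 /= <-] <-].
  pose c w := setT `&` g w @^-1` (if `[<A (g w x0)>] then A else ~` A).
  exists c; first by move=> w Dw; exists (if `[<A (g w x0)>] then A else ~` A);
    [case: asboolP; [left|right]|].
  apply/seteqP; split => [x cx|x /= /cell xx0 w Dw].
    apply/cell => w Dw; have := cx w Dw; rewrite /c => -[_] /=.
    by case: asboolP.
  by split => //=; have := xx0 w Dw; case: asboolP => /= Ax; tauto.
- move=> B [[c cP <-]] nB /=; apply: contrapT => FB.
  have [Be|/set0P[x0 Bx0]] := eqVneq (\bigcap_(i in D) c i) set0.
    by apply: FB; rewrite Be.
  apply: nB; exists (xi x0); first by exists x0.
  rewrite /h; apply/seteqP; split => [x /= /cell xx0 w Dw|x cx].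
    have := Bx0 w Dw; have [B' + <-] := cP w Dw.
    by move=> [->|->] /= [_ Ax0]; split => //=; have := xx0 w Dw; tauto.
  apply/cell => w Dw; have := cx w Dw; have := Bx0 w Dw; have [B' + <-] := cP w Dw.
  by move=> [->|->] /= [_ Ax0] [_ Ax]; tauto.
rewrite fsbig_image; last first.
  by move=> l l' /set_mem[x /= lx] _ /seteqP[/(_ x lx)]; rewrite /h/= lx.
rewrite (fsbig_widen L setT); first exact: fsbig_finType.
  exact: subsetT.
move=> l [_ nl] /=; rewrite (_ : h l = set0) ?F0//.
apply: contra_notP nl => hl; exact/set0P/eqP.
Qed.

Lemma measurable_label_itinerary (I : finType) d' (Y : measurableType d')
    (g : I -> X -> Y) (A : set Y) :
  (forall i, measurable (g i @^-1` A)) -> measurable_label (itinerary g A).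
Proof.
move=> mg; apply: (measurable_label_ffun (xi := fun i x => `[<A (g i x)>])) => i.
exact: measurable_label_set (mg i).
Qed.

End itinerary.

(** * Sets of zero entropy for a measure-preserving map *)

Section zero_entropy.
Context {R : realType} {d} {X : measurableType d} (P : probability X R).
Variable f : X -> X.
Hypothesis mf : measurable_fun setT f.
Hypothesis fP : forall A, measurable A -> P (f @^-1` A) = P A.
Implicit Types A B : set X.

Definition orbit_label A N := itinerary (fun n : 'I_N => iter n f) A.
Definition orbit_entropy A N := label_entropy P (orbit_label A N).

Lemma measurable_iter n : measurable_fun setT (iter n f).
Proof.
elim: n => [|n ih]; first exact: measurable_id.
exact: measurableT_comp mf ih.
Qed.

Lemma iter_preserving n A : measurable A -> P (iter n f @^-1` A) = P A.
Proof.
move=> mA; elim: n => // n ih; rewrite -ih -[RHS]fP; last first.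
  by rewrite -[X in measurable X]setTI; exact: measurable_iter.
by congr (P _); apply/funext => x /=; rewrite -iterSr.
Qed.

Lemma measurable_iter_preimage n A : measurable A -> measurable (iter n f @^-1` A).
Proof. by move=> mA; rewrite -[X in measurable X]setTI; exact: measurable_iter. Qed.

Lemma measurable_orbit_label A N : measurable A -> measurable_label (orbit_label A N).
Proof.
move=> mA; apply: measurable_label_itinerary => i.
exact: measurable_iter_preimage.
Qed.

Lemma orbit_entropy_ge0 A N : measurable A -> 0 <= orbit_entropy A N.
Proof. by move=> mA; apply/label_entropy_ge0/measurable_orbit_label. Qed.

Lemma KS_entropyE A : KS_entropy P f [set A; ~` A] =
  limn (fun N => (N%:R^-1 * orbit_entropy A N)%:E).
Proof.
rewrite /KS_entropy; congr (limn _); apply/funext => N; congr ((_ * _)%:E).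
rewrite (@static_entropy_join _ _ _ _ 'I_N _ _ val)//.
apply/seteqP; split => [_ [i _ <-]/=|n /= nN]; first exact: ltn_ord.
by exists (Ordinal nN).
Qed.

(** The last [n] letters at [x] are the first [n] letters at [iter m f x], which have the same law
    by invariance. *)
Lemma orbit_entropyD A m n : measurable A ->
  orbit_entropy A (m + n) <= orbit_entropy A m + orbit_entropy A n.
Proof.
move=> mA.
have mn := @measurable_orbit_label _ n mA; have mm := @measurable_orbit_label _ m mA.
have mn' : measurable_label (orbit_label A n \o iter m f).
  by move=> i; rewrite comp_preimage; exact: measurable_iter_preimage.
rewrite {3}/orbit_entropy -(label_entropy_preserving (@iter_preserving m) mn).
apply: le_trans (label_entropy_pair _ mm mn').
pose phi (p : {ffun 'I_m -> bool} * {ffun 'I_n -> bool}) : {ffun 'I_(m + n) -> bool} :=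
  [ffun i => match fintype.split i with inl j => p.1 j | inr k => p.2 k end].
rewrite /orbit_entropy (_ : orbit_label A (m + n) =
  phi \o (fun x => (orbit_label A m x, (orbit_label A n \o iter m f) x))).
  exact/label_entropy_comp/measurable_label_pair.
apply/funext => x; apply/ffunP => i; rewrite !ffunE/=.
by case: fintype.split_ordP => j ->; rewrite !ffunE//= addnC iterD.
Qed.

Lemma KS_entropy_eq0 A : measurable A ->
  KS_entropy P f [set A; ~` A] = 0%E <-> sublinear (orbit_entropy A).
Proof.
move=> mA; rewrite KS_entropyE sublinearP; last by move=> n; exact: orbit_entropy_ge0.
split=> [h0|/cvg_lim->//].
have : cvgn (fun n => n%:R^-1 * orbit_entropy A n).
  by apply: fekete => [n|m n]; [exact: orbit_entropy_ge0|exact: orbit_entropyD].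
move=> cvu; have := cvu => /EFin_lim; rewrite [LHS]h0 => -[l0].
by apply: cvg_EFin; [exact: nearW|rewrite l0; exact: cvu].
Qed.

Definition zero_entropy A := measurable A /\ sublinear (orbit_entropy A).

Lemma PinskerE : Pinsker P f = zero_entropy.
Proof.
apply/seteqP; split => A [mA].
  by move=> /(KS_entropy_eq0 mA).
by move=> /(KS_entropy_eq0 mA).
Qed.

Lemma zero_entropy0 : zero_entropy set0.
Proof.
split=> //; apply: sublinear_le (@sublinear0 R) => N.
have m1 : measurable_label (fun _ : X => tt).
  by move=> -[]; rewrite (_ : _ @^-1` _ = setT)//; apply/seteqP; split.
rewrite /orbit_entropy (_ : orbit_label set0 N = (fun=> [ffun=> false]) \o (fun=> tt)).
  rewrite (le_trans (label_entropy_comp _ _ m1))// (le_trans (label_entropy_le_ln_card _ m1))//.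
  by rewrite card_unit ln1.
by apply/funext => x; apply/ffunP => i; rewrite !ffunE asboolF.
Qed.

Lemma zero_entropyC A : zero_entropy A -> zero_entropy (~` A).
Proof.
move=> [mA sA]; split; first exact: measurableC.
apply: sublinear_le sA => N.
rewrite /orbit_entropy (_ : orbit_label (~` A) N =
    (fun g : {ffun _ -> _} => [ffun i => ~~ g i]) \o orbit_label A N).
  exact/label_entropy_comp/measurable_orbit_label.
by apply/funext => x; apply/ffunP => i; rewrite !ffunE asbool_neg.
Qed.

Lemma orbit_entropy_binary (op : bool -> bool -> bool) A B C N :
  measurable A -> measurable B ->
  (forall x, `[<C x>] = op `[<A x>] `[<B x>]) ->
  orbit_entropy C N <= orbit_entropy A N + orbit_entropy B N.
Proof.
move=> mA mB Cop.
have lA := @measurable_orbit_label _ N mA; have lB := @measurable_orbit_label _ N mB.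
apply: le_trans (label_entropy_pair _ lA lB).
pose phi (p : {ffun 'I_N -> bool} * {ffun 'I_N -> bool}) : {ffun 'I_N -> bool} :=
  [ffun i => op (p.1 i) (p.2 i)].
rewrite /orbit_entropy (_ : orbit_label C N =
  phi \o (fun x => (orbit_label A N x, orbit_label B N x))).
  exact/label_entropy_comp/measurable_label_pair.
by apply/funext => x; apply/ffunP => i; rewrite !ffunE.
Qed.

Lemma zero_entropyI A B : zero_entropy A -> zero_entropy B -> zero_entropy (A `&` B).
Proof.
move=> [mA sA] [mB sB]; split; first exact: measurableI.
apply: sublinear_le (sublinearD sA sB) => N; apply: (@orbit_entropy_binary andb _ _ _ N) => // x.
exact: asbool_and.
Qed.

Lemma zero_entropyU A B : zero_entropy A -> zero_entropy B -> zero_entropy (A `|` B).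
Proof.
move=> zA zB; rewrite -(setCK (A `|` B)) setCU; apply: zero_entropyC.
by apply: zero_entropyI; exact: zero_entropyC.
Qed.

Lemma orbit_entropy_le A N : measurable A ->
  orbit_entropy A N <= N%:R * label_entropy P (fun x => `[<A x>]).
Proof.
move=> mA; pose xi (i : 'I_N) x := `[<A (iter i f x)>].
have mxi i : measurable_label (xi i).
  by apply: measurable_label_set; exact: measurable_iter_preimage.
apply: (le_trans (label_entropy_ffun P mxi)).
rewrite (eq_bigr (fun=> label_entropy P (fun x => `[<A x>]))).
  by rewrite sumr_const card_ord mulr_natl.
move=> i _; apply: (label_entropy_preserving (@iter_preserving i)).
exact: measurable_label_set.
Qed.

(** An explicit rate for the vanishing of binary entropy at 0. With [s = sqrt p],
    [- p ln p = 2 s^2 ln (1 / s) <= 2 s], and [- (1 - p) ln (1 - p) <= p <= s]. *)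
Lemma label_entropy_set_le A : measurable A ->
  label_entropy P (fun x => `[<A x>]) <= 3 * Num.sqrt (pr P A).
Proof.
move=> mA; rewrite /label_entropy big_bool/=.
rewrite (_ : _ @^-1` [set true] = A); last first.
  by apply/seteqP; split => x /asboolP.
rewrite (_ : _ @^-1` [set false] = ~` A); last first.
  by apply/seteqP; split => x /=; [move=> /asboolPn|exact: asboolF].
rewrite prC//; set p := pr P A.
have p0 : 0 <= p by exact: pr_ge0.
have p1 : p <= 1 by exact: pr_le1.
have sp0 := sqrtr_ge0 p.
have sp1 : Num.sqrt p <= 1 by rewrite -[leRHS]sqrtr1 ler_sqrt.
have sqp : p = Num.sqrt p * Num.sqrt p by rewrite -expr2 sqr_sqrtr.
have [pe|pn0] := eqVneq p 0; first by rewrite pe subr0 ln1 mulr0 mul0r addr0 oppr0 sqrtr0 mulr0.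
have pgt : 0 < p by rewrite lt_neqAle eq_sym pn0.
have spgt : 0 < Num.sqrt p by rewrite sqrtr_gt0.
have h1 : - (p * ln p) <= 2 * Num.sqrt p.
  have lnp : ln p = ln (Num.sqrt p) + ln (Num.sqrt p) by rewrite {1}sqp lnM.
  have : ln (Num.sqrt p)^-1 <= (Num.sqrt p)^-1 by rewrite ltW// ln_sublinear// invr_gt0.
  rewrite lnV ?posrE// => lnsp.
  have /(ler_wpM2l p0) : - ln p <= 2 * (Num.sqrt p)^-1 by rewrite lnp; lra.
  have -> : p * (2 * (Num.sqrt p)^-1) = 2 * Num.sqrt p.
    by rewrite mulrCA {1}sqp mulfK ?gt_eqF.
  by rewrite mulrN.
have h2 : - ((1 - p) * ln (1 - p)) <= Num.sqrt p.
  have psp : p <= Num.sqrt p by rewrite {1}sqp ler_piMl.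
  have [p1'|] := ltP p 1; last first.
    move=> p1'; have -> : p = 1 by apply/le_anti/andP.
    by rewrite subrr mul0r oppr0 sqrtr1.
  have q0 : 0 < 1 - p by rewrite subr_gt0.
  apply: le_trans psp.
  have := @le_ln1Dx R ((1 - p)^-1 - 1); rewrite addrCA subrr addr0 lnV ?posrE//.
  have : 0 < (1 - p)^-1 by rewrite invr_gt0.
  move=> q1 /(_ _) h; have {}h : - ln (1 - p) <= (1 - p)^-1 - 1 by apply: h; lra.
  rewrite -mulrN (le_trans (ler_wpM2l (ltW q0) h))// mulrBr divff ?gt_eqF//.
  lra.
by rewrite opprD (le_trans (lerD h1 h2))//; lra.
Qed.

(* The itinerary of [A] is determined by those of [B] and [A `+` B]. *)
Lemma zero_entropy_closed A : measurable A ->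
  (forall e, 0 < e -> exists2 B, zero_entropy B & pr P (A `+` B) <= e) ->
  zero_entropy A.
Proof.
move=> mA Ae; split => // e e0.
(* A difference of measure at most [r ^+ 2] costs at most [3 * r = e / 2] per step. *)
pose r := e / 6; have r0 : 0 < r by rewrite divr_gt0.
have [B [mB sB] AB] := Ae (r ^+ 2) (exprn_gt0 _ r0).
have e20 : 0 < e / 2 by rewrite divr_gt0.
have [C CP] := sB _ e20; exists C => N.
have mAB : measurable (A `+` B) by rewrite setY_def; apply: measurableU; exact: measurableD.
have := @orbit_entropy_binary addb B (A `+` B) A N mB mAB.
move=> /(_ _)/le_trans; apply.
  move=> x; rewrite /setY/= /setU/setD/=.
  by do 3 case: asboolP => /=; tauto.
rewrite (splitr e) mulrDl addrAC; apply: lerD => //.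
rewrite (le_trans (@orbit_entropy_le _ N mAB))// mulrC ler_wpM2r//.
rewrite (le_trans (label_entropy_set_le mAB))//.
have : Num.sqrt (pr P (A `+` B)) <= r by rewrite -(ger0_norm (ltW r0)) -sqrtr_sqr ler_sqrt// exprn_ge0// ltW.
by rewrite /r; lra.
Qed.

Lemma sigma_algebra_zero_entropy : sigma_algebra setT zero_entropy.
Proof.
apply: (sigma_algebra_approx (P := P)).
- by move=> A [].
- exact: zero_entropy0.
- exact: zero_entropyC.
- exact: zero_entropyU.
- exact: zero_entropy_closed.
Qed.

End zero_entropy.

(** * Step sets in a product *)

Section step_sets.
Context {R : realType} {d1 d2} {T : measurableType d1} {X : measurableType d2}.
Variables (m : probability T R) (mu : probability X R).
Let mut : probability (T * X)%type R := (m \x mu)%E.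

Definition step_set (I : finType) (c : T -> I) (D : I -> set X) : set (T * X) :=
  [set z | D (c z.1) z.2].

Lemma step_setE (I : finType) (c : T -> I) (D : I -> set X) :
  step_set c D = \bigcup_i (c @^-1` [set i] `*` D i).
Proof.
apply/seteqP; split => [z Dz|z [i _ [/= <-]]//].
by exists (c z.1).
Qed.

Lemma step_set_sigma_algebra (S : set (set T)) (Q : set (set X)) (I : finType)
    (c : T -> I) (D : I -> set X) :
  (forall i, S (c @^-1` [set i])) -> (forall i, Q (D i)) ->
  product_sigma_algebra S Q (step_set c D).
Proof.
move=> Sc QD; rewrite step_setE; apply: sigma_algebra_countable_bigcup.
  exact: smallest_sigma_algebra.
move=> i; apply: sub_sigma_algebra.
by exists (c @^-1` [set i]) => //; exists (D i).
Qed.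

Lemma measurable_step_set (I : finType) (c : T -> I) (D : I -> set X) :
  measurable_label c -> (forall i, measurable (D i)) -> measurable (step_set c D).
Proof.
move=> mc mD; rewrite step_setE; apply: fin_bigcup_measurable.
  exact: finite_finset.
by move=> i _; apply: measurableX => //; exact: mc.
Qed.

Lemma prX A B : measurable A -> measurable B -> pr mut (A `*` B) = pr m A * pr mu B.
Proof.
move=> mA mB; apply: EFin_inj; rewrite EFinM -!prE//; last exact: measurableX.
exact: product_measure1E.
Qed.

Definition steps : set (set (T * X)) := [set A | exists (I : finType) (c : T -> I) D,
  [/\ measurable_label c, forall i, measurable (D i) & A = step_set c D]].

(** Step sets form an algebra containing the rectangles, refinements being given by pairs of
    labels. *)
Lemma step_set_approx E e : measurable E -> 0 < e ->
  exists2 B, steps B & pr mut (E `+` B) <= e.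
Proof.
apply: (measurable_approx _ (measurable_prod_measurableType T X)).
- move=> _ [A mA [B mB <-]]; exists bool, (fun t => `[<A t>]), (fun b => if b then B else set0).
  split; [exact: measurable_label_set|by case|].
  by apply/seteqP; split => z; rewrite /step_set/=; case: asboolP => // ? [].
- by move=> _ [I [c [D [mc mD ->]]]]; exact: measurable_step_set.
- exists unit, (fun=> tt), (fun=> set0); split => // -[].
  by rewrite (_ : _ @^-1` _ = setT)//; apply/seteqP; split.
- move=> _ [I [c [D [mc mD ->]]]]; exists I, c, (fun i => ~` D i); split => // i.
  exact: measurableC.
- move=> _ _ [I [c [D [mc mD ->]]]] [J [c' [D' [mc' mD' ->]]]].
  exists (I * J)%type, (fun t => (c t, c' t)), (fun i => D i.1 `|` D' i.2).
  split => //; first exact: measurable_label_pair.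
  by move=> i; exact: measurableU.
Qed.

(* Some section of [W] over [C] is not worse than the average one. *)
Lemma section_selection (Q : set (set X)) (N : set T) (C : set T) (D : set X)
    (W : set (T * X)) (e : R) :
  Q `<=` measurable -> Q set0 -> m.-negligible N -> measurable C -> measurable D ->
  measurable W ->
  (forall t, C t -> ~ N t -> Q (D `+` xsection W t)) -> 0 < e ->
  exists2 A, Q A & pr mut (C `*` (D `+` A)) <= pr mut (W `&` (C `*` setT)) + e.
Proof.
move=> mQ Q0 Nn mC mD mW QW e0; apply: contrapT => nA.
have mZ : measurable (W `&` (C `*` setT)) by apply: measurableI => //; exact: measurableX.
set q := pr mut _ in nA.
have big A : Q A -> q + e < pr m C * pr mu (D `+` A).
  move=> QA; rewrite ltNge; apply/negP => qA; apply: nA; exists A => //.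
  by rewrite prX//; apply: measurableY => //; exact: mQ.
have q0 : 0 <= q by exact: pr_ge0.
(* [set0] is an admissible choice, so a null [C] would already contradict [big]. *)
have mC0 : 0 < pr m C.
  rewrite lt_neqAle pr_ge0 andbT eq_sym; apply/eqP => mC0.
  by have := big _ Q0; rewrite mC0 mul0r; lra.
(* Applied to [D] plus a section of [W] at [t] in [C], [big] says that [m C] times the measure of
   this section exceeds [q + e]; integrating over [C] gives [(q + e) m(C) <= m(C) q], which is
   absurd. *)
have : (((q + e) * pr m C)%:E <= (pr m C * q)%:E)%E.
  rewrite EFinM [X in (_ <= X)%E]EFinM -(prE mut mZ).
  rewrite -(prE m mC) -[X in ((_)%:E * m X)%E]setIT -integral_indic//.
  have mi : measurable_fun setT (fun t => (\1_C t)%:E : \bar R).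
    by apply/measurable_EFinP; exact: measurable_indic.
  have qe0 : (0 <= (q + e)%:E)%E by rewrite lee_fin; lra.
  rewrite -ge0_integralZl// /mut/= /product_measure1 -ge0_integralZl//; last first.
    exact: measurable_fun_xsection.
  apply: ae_ge0_le_integral => //.
  - by move=> t _; rewrite mule_ge0.
  - exact: measurable_funeM.
  - by move=> t _; rewrite mule_ge0.
  - by apply: measurable_funeM; exact: measurable_fun_xsection.
  apply: negligibleS Nn => t /= nle; apply: contrapT => Nt; apply: nle => _.
  rewrite /indic; have [Ct|nCt] := pselect (C t); last first.
    by rewrite memNset// mule0 mule_ge0.
  rewrite mem_set// mule1.
  have -> : xsection (W `&` (C `*` setT)) t = D `+` (D `+` xsection W t).
    rewrite setYA setYK set0Y; apply/seteqP; split => x.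
      by move=> /xsectionP[Wtx _]; apply/xsectionP.
    by move=> /xsectionP Wtx; apply/xsectionP.
  have mDW : measurable (D `+` xsection W t) by exact: mQ (QW t Ct Nt).
  rewrite (prE m mC) (prE mu (measurableY mD mDW)).
  by rewrite -EFinM lee_fin ltW// big//; exact: QW.
rewrite lee_fin (mulrC _ q) ler_pM2r//; lra.
Qed.

(** On each piece of an approximating step set the constant value is replaced by a member of [Q]
    that is as close to it as the sections of [E] are on average. The replacement thus costs no more
    than the first approximation, up to the selection error: three errors of [e / 3]. *)
Lemma step_set_section_approx (Q : set (set X)) (N : set T) E e :
  Q `<=` measurable -> Q set0 -> m.-negligible N -> measurable E ->
  (forall t, ~ N t -> Q (xsection E t)) -> 0 < e ->
  exists2 B, product_sigma_algebra measurable Q B & pr mut (E `+` B) <= e.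
Proof.
move=> mQ Q0 Nn mE QE e0.
have e30 : 0 < e / 3 by rewrite divr_gt0.
have [_ [I [c [D [mc mD ->]]]] ED] := step_set_approx mE e30.
have mcD := measurable_step_set mc mD; have mW := measurableY mE mcD.
set W := E `+` _ in mW ED.
(* The selection error of one piece; over [#|I|] pieces they sum to at most [e / 3], and the
   successor keeps the divisor positive. *)
have r0 : 0 < e / 3 / #|I|.+1%:R by rewrite divr_gt0// ltr0n.
have /choice[A /all_and2[QA AP]] : forall i, exists A, Q A /\
    pr mut ((c @^-1` [set i]) `*` (D i `+` A)) <=
    pr mut (W `&` ((c @^-1` [set i]) `*` setT)) + e / 3 / #|I|.+1%:R.
  move=> i; have [] // := @section_selection Q N (c @^-1` [set i]) (D i) W _ mQ Q0 Nn (mc i) (mD i) mW _ r0.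
  (* Over this piece the section of [W] is that of [E] plus [D i], so adding [D i] once more gives
     back the section of [E]. *)
  - move=> t /= ct Nt; rewrite (_ : D i `+` _ = xsection E t); first exact: QE.
    suff -> : xsection W t = xsection E t `+` D i.
      by rewrite (setYC (xsection E t)) setYA setYK set0Y.
    rewrite -ct; apply/seteqP; split => x.
      by move=> /xsectionP[[Ex nD]|[Dx nE]]; [left|right]; split => //; [apply/xsectionP|move=> /xsectionP].
    by move=> [[/xsectionP Ex nD]|[Dx nE]]; apply/xsectionP; [left|right]; split => // Ex; apply: nE; apply/xsectionP.
  - by move=> A QA AP; exists A.
exists (step_set c A); first by apply: step_set_sigma_algebra.
have mA i : measurable (A i) by exact: mQ.
have mcA := measurable_step_set mc mA.
rewrite (le_trans (prY_triangle mut mE mcD mcA))//.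
have mfst : measurable_label (fun z : T * X => c z.1).
  move=> i; rewrite (_ : _ @^-1` _ = (c @^-1` [set i]) `*` setT); last first.
    by apply/seteqP; split => z /=; tauto.
  by apply: measurableX => //; exact: mc.
have fstE i : (fun z : T * X => c z.1) @^-1` [set i] = (c @^-1` [set i]) `*` setT.
  by apply/seteqP; split => z /=; tauto.
have : pr mut (step_set c D `+` step_set c A) <= pr mut W + e / 3.
  have mDA := measurableY mcD mcA.
  rewrite -(pr_label_sum mut mfst mDA) -(pr_label_sum mut mfst mW).
  apply: (@le_trans _ _ (\sum_i (pr mut (W `&` ((fun z : T * X => c z.1) @^-1` [set i])) + e / 3 / #|I|.+1%:R))).
    apply: ler_sum => i _; rewrite fstE; apply: le_trans (AP i).
    apply: pr_le; [|by apply: measurableX (mc i) _; exact: measurableY|].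
      by apply: measurableI => //; rewrite -fstE; exact: mfst.
    by move=> [t x]; rewrite /step_set /setY /setD/setU/= => -[] + [<-].
  rewrite big_split/= lerD2l sumr_const -[leLHS]mulr_natr.
  by rewrite mulrAC ler_pdivrMr ?ltr0n// ler_pM2l// ler_nat.
lra.
Qed.

End step_sets.

(** * The rotation *)

Section torus.
Context {R : realType}.
Implicit Types (s : R) (t : torus R).

Lemma lebesgue_measureD (c : R) (A : set R) : measurable A ->
  lebesgue_measure ((fun x => x + c) @^-1` A) = lebesgue_measure A.
Proof.
move=> mA; rewrite -[LHS]/(pushforward lebesgue_measure
  ((fun x => x + c) : _ -> measurableTypeR R) A).
apply/esym/lebesgue_measure_unique => //=.
  by apply: measurable_funD => //; exact: measurable_cst.
move=> _ _ [[a b]] _ <-.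
rewrite /pushforward (_ : _ @^-1` _ = `]a - c, b - c]%classic); last first.
  by apply/seteqP; split => x; rewrite /= !in_itv/= ltrBlDr lerBrDr.
rewrite !lebesgue_measure_itv/= !lte_fin ltrD2r; case: ifP => // _.
by rewrite -!EFinD; congr EFin; ring.
Qed.

Lemma measurable_floor : measurable_fun setT (fun x : R => (Num.floor x)%:~R : R).
Proof.
by apply: nondecreasing_measurable => // x y xy; rewrite ler_int le_floor.
Qed.

Lemma measurable_torus_val : measurable_fun setT (@torus_val R).
Proof. by move=> _ B mB; exists B. Qed.

Lemma measurable_fun_torus d (Z : measurableType d) (f : Z -> torus R) :
  measurable_fun setT (fun z => torus_val (f z)) -> measurable_fun setT f.
Proof.
move=> mf _ _ [B mB <-]; rewrite !setTI -comp_preimage -[X in measurable X]setTI.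
exact: mf.
Qed.

Lemma measurable_frac : measurable_fun setT (@Defs.frac R).
Proof.
apply: measurable_fun_torus => /=.
apply: measurable_funB; [exact: measurable_id|exact: measurable_floor].
Qed.

Lemma floor_eq0 (x : R) : 0 <= x < 1 -> Num.floor x = 0.
Proof. by move=> x01; apply: floor_def; rewrite add0r. Qed.

Lemma floor_eq1 (x : R) : 1 <= x < 2 -> Num.floor x = 1.
Proof. by move=> x12; apply: floor_def; rewrite intrD. Qed.

Lemma frac_val t : Defs.frac (torus_val t) = t.
Proof.
apply: torus_val_inj => /=; rewrite floor_eq0 ?subr0//; exact: torus_valP.
Qed.

(** The cocycle identity of the integer part: the turns made by [a], then those made by [s] from
    where [a] ended. It is behind the group law [twistD]. *)
Lemma floor_fracD (a s : R) :
  Num.floor (s + torus_val (Defs.frac a)) + Num.floor a = Num.floor (s + a).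
Proof.
by rewrite -[X in _ + X](@intrKfloor R) -floorDrz ?intr_int// -addrA subrK.
Qed.

Lemma frac_fracD (a s : R) : Defs.frac (torus_val (Defs.frac a) + s) = Defs.frac (a + s).
Proof.
apply: torus_val_inj => /=.
by rewrite (addrC _ s) (addrC a s) -(floor_fracD a s)/= intrD; ring.
Qed.

Lemma measurable_rotation s : measurable_fun setT (rotation s).
Proof.
apply: (measurableT_comp measurable_frac); apply: measurable_funD => //.
exact: measurable_torus_val.
Qed.

(** The rotation exchanges two intervals: points of [[q, 1[] are reached by the translation by [q],
    those of [[0, q[] by the translation by [q - 1]. *)
Lemma torus_measure_rotation s A : measurable A ->
  torus_measure (rotation s @^-1` A) = torus_measure A.
Proof.
move=> mA; rewrite /torus_measure; set V := _ @` A.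
have mV : measurable V by exact: measurable_torus_val_image.
pose q := torus_val (Defs.frac s).
have /andP[q0 q1] : 0 <= q < 1 by exact: torus_valP.
have VT x : V x -> 0 <= x < 1 by move=> [t _ <-]; exact: torus_valP.
have rotE t : torus_val (rotation s t) =
    if torus_val t < 1 - q then torus_val t + q else torus_val t + (q - 1).
  have /andP[t0 t1] := torus_valP t.
  have -> : rotation s t = Defs.frac (q + torus_val t).
    by rewrite /rotation addrC; exact/esym/frac_fracD.
  rewrite /= (addrC q).
  case: ifPn => [tq|]; last rewrite -leNgt => tq.
    have -> : Num.floor (torus_val t + q) = 0 by apply: floor_eq0; apply/andP; split; lra.
    by rewrite mulr0z subr0.
  have -> : Num.floor (torus_val t + q) = 1 by apply: floor_eq1; apply/andP; split; lra.
  by ring.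
have VA t : V (torus_val t) <-> A t.
  by split => [[u Au /torus_val_inj <-]//|At]; exists t.
pose V1 := V `&` `[q, +oo[; pose V2 := V `&` `]-oo, q[.
have mV1 : measurable V1 by exact: measurableI.
have mV2 : measurable V2 by exact: measurableI.
have mp (c : R) (B : set R) : measurable B -> measurable ((fun x => x + c) @^-1` B).
  move=> mB; rewrite -[X in measurable X]setTI.
  by apply: (measurable_funD (@measurable_id _ _ _) (measurable_cst c)).
rewrite (_ : _ @` _ = (fun x => x + q) @^-1` V1 `|` (fun x => x + (q - 1)) @^-1` V2).
  transitivity (lebesgue_measure ((fun x => x + q)%R @^-1` V1) +
      lebesgue_measure ((fun x => x + (q - 1))%R @^-1` V2))%E.
    apply: measureU; [exact: mp|exact: mp|].
    by apply/seteqP; split => // x [[/VT + _] [/VT + _]]; lra.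
  rewrite !lebesgue_measureD//; transitivity (lebesgue_measure (V1 `|` V2)).
    apply/esym/measureU => //.
    by apply/seteqP; split => // x [[_ +] [_ +]]; rewrite /= !in_itv/=; lra.
  rewrite -setIUr (_ : _ `|` _ = setT) ?setIT//.
  by apply/seteqP; split => // x _ /=; rewrite !in_itv/= andbT; case: (leP q x); [left|right].
apply/seteqP; split => [_ [t /= At <-]|x /= [[Vx qx]|[Vx qx]]].
- have := (VA _).2 At; rewrite rotE; have /andP[t0 t1] := torus_valP t.
  by case: ifPn => tq Vt; [left|right]; split => //=; rewrite in_itv/=; lra.
- have /andP[x0 x1] := VT _ Vx; move: qx; rewrite /= in_itv/= andbT => qx.
  have xP : 0 <= x < 1 by lra.
  exists (Torus xP) => //=; apply/VA; rewrite rotE/= ifT//; lra.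
- have /andP[x0 x1] := VT _ Vx; move: qx; rewrite /= in_itv/= => qx.
  have xP : 0 <= x < 1 by lra.
  exists (Torus xP) => //=; apply/VA; rewrite rotE/= ifF//; lra.
Qed.

End torus.

(** * Twisted rotations *)

Section twist.
Context {R : realType} {d} {X : measurableType d} (mu : probability X R).
Variables (T : int * int -> X -> X).
Hypothesis mT : forall w, measurable_fun setT (T w).
Hypothesis T0 : T 0 = id.
Hypothesis TD : forall w u, T w \o T u = T (w + u).
Hypothesis Tmu : invariant_measure T mu.
Let m : probability (torus R) R := @torus_measure R.
Let mut : probability (torus R * X)%type R := (m \x mu)%E.
Implicit Types (s : R) (a : int).

(** [twist 1 beta] is the skew product and [twist 0 u] is the map [S_u]; for an integer [u] the
    latter fixes the base and applies [T (0, u)] on every fibre. *)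
Definition twist a s (z : torus R * X) : torus R * X :=
  (rotation s z.1, T (a, Num.floor (s + torus_val z.1)) z.2).

Lemma twistD a b s r z : twist a s (twist b r z) = twist (a + b) (s + r) z.
Proof.
rewrite /twist/=; congr pair.
  by rewrite /rotation frac_fracD -addrA (addrC r).
have addE (p q : int * int) : p + q = (p.1 + q.1, p.2 + q.2) by [].
rewrite -[LHS]/((T _ \o T _) z.2) TD addE /=; congr (T (_, _) z.2).
by rewrite (addrC _ r) floor_fracD; congr Num.floor; ring.
Qed.

Lemma twist0 z : twist 0 0 z = z.
Proof.
case: z => t x; rewrite /twist/= /rotation addr0 add0r frac_val floor_eq0 ?torus_valP//.
by rewrite -[(0, 0)]/(0 : int * int) T0.
Qed.

Lemma iter_twist a s n z : iter n (twist a s) z = twist (a *+ n) (s *+ n) z.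
Proof.
elim: n => [|n ih]; first by rewrite /= !mulr0n twist0.
by rewrite iterS ih twistD !mulrS.
Qed.

(** The time [s] may vary with the point, as it does in the sets that compare neighbouring sections.
    The integer part takes countably many values, and on each of them a single [T (a, k)] acts. *)
Lemma measurable_fun_twist d' (Z : measurableType d') a (s : Z -> R)
    (t : Z -> torus R) (x : Z -> X) :
  measurable_fun setT s -> measurable_fun setT t -> measurable_fun setT x ->
  measurable_fun setT (fun z => twist a (s z) (t z, x z)).
Proof.
move=> ms mt mx; have mst : measurable_fun setT (fun z => s z + torus_val (t z)).
  by apply: measurable_funD => //; exact: measurableT_comp measurable_torus_val mt.
apply: measurable_fun_pair.
  apply: (measurableT_comp measurable_frac).
  by rewrite (_ : (fun z => _) = (fun z => s z + torus_val (t z)))//; apply/funext => z; rewrite addrC.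
move=> _ B mB; rewrite setTI.
rewrite (_ : _ @^-1` B = \bigcup_k
    ((fun z => s z + torus_val (t z)) @^-1` [set r | Num.floor r = k] `&` x @^-1` (T (a, k) @^-1` B))).
  apply: countable_bigcupT_measurable => [|k]; first exact: countableP.
  apply: measurableI; last first.
    rewrite -[X in measurable X]setTI; apply: mx => //.
    by rewrite -[X in measurable X]setTI; exact: mT.
  rewrite -[X in measurable X]setTI; apply: mst => //.
  rewrite (_ : [set r | _] = (fun r : R => (Num.floor r)%:~R : R) @^-1` [set k%:~R]).
    by rewrite -[X in measurable X]setTI; exact: measurable_floor.
  by apply/seteqP; split => r /= => [->//|/intr_inj].
by apply/seteqP; split => [z Bz|z [k _ [<-]]//]; exists (Num.floor (s z + torus_val (t z))).
Qed.

Lemma measurable_twist a s : measurable_fun setT (twist a s).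
Proof.
rewrite (_ : twist a s = fun z => twist a s (z.1, z.2)); last by apply/funext => -[].
exact: measurable_fun_twist.
Qed.

(** On a rectangle: the fibre over [t] is moved by one [T w], which preserves [mu], and the base by
    a rotation. *)
Lemma twist_preserving a s E : measurable E -> mut (twist a s @^-1` E) = mut E.
Proof.
move=> mE; rewrite -[LHS]/(pushforward mut (twist a s) E).
apply/esym; apply: product_measure_unique mE => [|mtw A B mA mB].
  exact: measurable_twist.
have mrA : measurable (rotation s @^-1` A).
  by rewrite -[X in measurable X]setTI; exact: measurable_rotation.
transitivity (mut ((rotation s @^-1` A) `*` B)).
  apply: eq_integral => t _ /=.
  have [At|nAt] := pselect (A (rotation s t)); last first.
    rewrite (_ : xsection _ _ = set0); last first.
      by apply/seteqP; split => // x /xsectionP[].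
    by rewrite notin_xsectionX// notin_setE.
  rewrite in_xsectionX ?inE//; rewrite -(Tmu (a, Num.floor (s + torus_val t)) mB).
  congr (mu _); apply/seteqP; split => x.
    by move=> /xsectionP[].
  by move=> Bx; apply/xsectionP.
rewrite [LHS]product_measure1E//; congr (_ * _)%E.
exact: torus_measure_rotation.
Qed.

Variable beta : R.
Let Theta := twist 1 beta.

Lemma zero_entropy_twist a s E :
  zero_entropy mut Theta E -> zero_entropy mut Theta (twist a s @^-1` E).
Proof.
move=> [mE sE]; split.
  by rewrite -[X in measurable X]setTI; exact: measurable_twist.
apply: sublinear_le sE => N.
have -> : orbit_entropy mut Theta E N = label_entropy mut (orbit_label Theta E N \o twist a s).
  apply/esym/label_entropy_preserving; first exact: twist_preserving.
  by apply: measurable_orbit_label mE; exact: measurable_twist.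
rewrite le_eqVlt; apply/orP; left; apply/eqP; congr label_entropy.
apply/funext => z; apply/ffunP => i; rewrite !ffunE/=.
by congr (`[< E _ >]); rewrite !iter_twist !twistD addrC (addrC s).
Qed.

Let q (i : nat) := torus_val (Defs.frac (beta *+ i)).

(** The fractional parts of [beta *+ i] and [t] produce a carry exactly when [t] reaches [1 - q i].
    The path over [t] is thus governed by comparisons of [t] with numbers that do not depend on
    [t]. *)
Lemma rotation_threshold (t : torus R) (i : nat) :
  Num.floor (beta *+ i + torus_val t) =
    Num.floor (beta *+ i) + ~~ (torus_val t < 1 - q i) :> int /\
  torus_val (rotation (beta *+ i) t) = torus_val t + q i - (~~ (torus_val t < 1 - q i))%:R.
Proof.
have /andP[t0 t1] := torus_valP t.
have /andP[q0 q1] : 0 <= q i < 1 by exact: torus_valP.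
have fl : Num.floor (torus_val t + q i) = ~~ (torus_val t < 1 - q i) :> int.
  case: ltP => tq /=.
    by apply: floor_eq0; apply/andP; split; lra.
  by apply: floor_eq1; apply/andP; split; lra.
split; first by rewrite addrC -floor_fracD addrC fl.
have -> : rotation (beta *+ i) t = Defs.frac (q i + torus_val t).
  by rewrite /rotation addrC; exact/esym/frac_fracD.
by rewrite /= (addrC (q i)) fl; case: (~~ _).
Qed.

Lemma label_entropy_torus_thresholds (I : finType) (theta : I -> R) :
  let xi := (fun z : torus R * X => [ffun i => torus_val z.1 < theta i]) in
  measurable_label xi /\ label_entropy mut xi <= ln #|I|.+1%:R.
Proof.
move=> xi; have mxi : measurable_label xi.
  apply: (measurable_label_ffun (xi := fun i (z : torus R * X) => torus_val z.1 < theta i)) => i.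
  rewrite (_ : (fun z => _) = (fun z => `[<((@torus_val R \o fst) @^-1` `]-oo, theta i[) z>])).
    apply: measurable_label_set; rewrite -[X in measurable X]setTI.
    by apply: (measurableT_comp measurable_torus_val).
  by apply/funext => z; apply/idP/asboolP; rewrite /= in_itv.
split=> //; apply: (@label_entropy_thresholds _ _ _ mut I xi (fun z => torus_val z.1) theta) => //.
by move=> z i; rewrite ffunE.
Qed.

(** Zero-entropy sets being a sigma-algebra, initial arcs suffice; their itineraries are read off
    linearly many thresholds, hence have logarithmic entropy. *)
Lemma zero_entropy_fst C : measurable C -> zero_entropy mut Theta (fst @^-1` C).
Proof.
have [z0 zC zU] := sigma_algebra_zero_entropy (@measurable_twist 1 beta) (@twist_preserving 1 beta).
move=> [B + <-]; rewrite setTI -comp_preimage.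
have -> : measurable B = <<s @RGenInftyO.G R >> B.
  exact: (congr1 (fun S => S B) (@RGenInftyO.measurableE R)).
apply: (@smallest_sub _ _ _ [set B | zero_entropy mut Theta ((@torus_val R \o fst) @^-1` B)]).
  split; first by rewrite /= preimage_set0.
    by move=> A zA; rewrite setTD /= preimage_setC -setTD; exact: zC.
  by move=> F zF; rewrite /= preimage_bigcup; exact: zU.
move=> _ [c ->] /=; set E := _ @^-1` _.
have mE : measurable E.
  rewrite -[X in measurable X]setTI.
  by apply: (measurableT_comp measurable_torus_val).
split => //.
(* The first threshold decides the carry; the rotated point lies below [c] iff [t < c - q i] without
   carry and iff [t < c + 1 - q i] with it. *)
pose theta N (p : 'I_N * 'I_3) : R := if p.2 == 0 then 1 - q p.1
  else if p.2 == 1 then c - q p.1 else c + 1 - q p.1.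
have bound N : orbit_entropy mut Theta E N <= ln 3 + ln N.+1%:R.
  have [mxi] := label_entropy_torus_thresholds (@theta N).
  set xi := (fun z => _) in mxi * => xiN.
  pose phi (g : {ffun 'I_N * 'I_3 -> bool}) : {ffun 'I_N -> bool} :=
    [ffun i => if g (i, 0) then g (i, 1) else g (i, 2)].
  have -> : orbit_entropy mut Theta E N = label_entropy mut (phi \o xi).
    congr label_entropy; apply/funext => z; apply/ffunP => i; rewrite !ffunE.
    have -> : `[<E (iter i Theta z)>] = (torus_val (rotation (beta *+ i) z.1) < c).
      by rewrite iter_twist; apply/asboolP/idP; rewrite /E /= in_itv.
    have [_ ->] := rotation_threshold z.1 i; rewrite /theta /=.
    case: ifPn => _ /=; apply/idP/idP; lra.
  apply: (le_trans (label_entropy_comp mut phi mxi)); apply: (le_trans xiN).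
  (* [3 N] thresholds allow [3 N + 1 <= 3 (N + 1)] labels. *)
  rewrite -lnM ?posrE ?ltr0n// ler_ln ?posrE ?ltr0n ?mulr_gt0 ?ltr0n// -natrM ler_nat.
  by rewrite card_prod !card_ord; lia.
apply: sublinear_le bound _; apply: sublinearD; last exact: sublinear_ln.
by move=> e e0; exists (ln 3) => n; rewrite lerDr mulr_ge0// ltW.
Qed.

End twist.

(** * Directional entropy as entropy of the skew product *)

Section directional.
Context {R : realType} {d} {X : measurableType d} (mu : probability X R).
Variables (T : int * int -> X -> X).
Hypothesis mT : forall w, measurable_fun setT (T w).
Hypothesis T0 : T 0 = id.
Hypothesis TD : forall w u, T w \o T u = T (w + u).
Hypothesis Tmu : invariant_measure T mu.
Variable beta : R.
Let m : probability (torus R) R := @torus_measure R.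
Let mut : probability (torus R * X)%type R := (m \x mu)%E.
Let Theta := twist T 1 beta.

Definition strip_entropy (A : set X) (b : R) (N : nat) : R :=
  static_entropy mu (join_partitions (strip_window beta b N)
    (fun w => preimage_set_system setT (T w) [set A; ~` A])).

Lemma finite_strip_window (b : R) N : finite_set (strip_window beta b N).
Proof.
(* [M] exceeds every height in the window in absolute value, so heights shifted by [M] are naturals
   at most [2 M]. *)
pose M := (Num.truncn (`|beta| * N%:R + `|b|)).+1.
apply: (@sub_finite_set _ _ ((fun p : 'I_N.+1 * 'I_(2 * M).+1 => ((p.1)%:Z, (p.2)%:Z - M%:Z)) @` setT)); last first.
  exact/finite_image/finite_finset.
move=> [i n] [/= /andP[h1 h2] /andP[i0 iN]].
case: i i0 iN h1 h2 => //= i _ iN h1 h2.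
have iN' : (i < N.+1)%N by lia.
have MP : `|beta| * N%:R + `|b| < M%:R by exact: truncnS_gt.
have nM : `|n%:~R : R| < M%:R.
  apply: le_lt_trans MP.
  have bi : `|beta * i%:~R| <= `|beta| * N%:R.
    by rewrite normrM ler_wpM2l// ger0_norm// ler_nat; lia.
  have := ler_norm (beta * i%:~R); have := ler_norm (- (beta * i%:~R)).
  have := ler_norm b; rewrite normrN => ? ? ?; rewrite ler_norml.
  by apply/andP; split; lra.
have {}nM : (`|n| < M%:Z)%R by rewrite -(ltr_int R) intr_norm.
have nM' : (`|(n + M%:Z)%R|%N < (2 * M).+1)%N by lia.
exists (Ordinal iN', Ordinal nM') => //=; congr pair; lia.
Qed.

Lemma strip_labels (A : set X) (b : R) N :
  exists (I : finType) (e : I -> int * int), range e = strip_window beta b N /\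
    strip_entropy A b N = label_entropy mu (itinerary (T \o e) A).
Proof.
have /finite_seqP[s sE] := finite_strip_window b N.
have sr : range (val : seq_sub s -> int * int) = strip_window beta b N.
  rewrite sE; apply/seteqP; split => [_ [w _ <-]|w ws]; first exact: valP.
  by exists (SeqSub ws).
exists (seq_sub s), val; split => //.
exact: static_entropy_join.
Qed.

Let mitin (A : set X) (I : finType) (e : I -> int * int) : measurable A ->
  measurable_label (itinerary (T \o e) A).
Proof.
move=> mA; apply: measurable_label_itinerary => i.
by rewrite -[X in measurable X]setTI; exact: mT.
Qed.

Lemma strip_entropy_ge0 A b N : measurable A -> 0 <= strip_entropy A b N.
Proof.
move=> mA; have [I [e [_ ->]]] := strip_labels A b N.
exact/label_entropy_ge0/mitin.
Qed.

(** The sequences are nonnegative, so a vanishing supremum of upper limits forces each of them to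
    converge to 0; the upper limit does here what Fekete's lemma does along orbits. *)
Lemma directional_entropy_eq0 A : measurable A ->
  directional_entropy mu T beta [set A; ~` A] = 0%E <->
  forall b, 0 < b -> sublinear (strip_entropy A b).
Proof.
move=> mA; rewrite /directional_entropy.
pose u b (N : nat) : \bar R := (N%:R^-1 * strip_entropy A b N)%:E.
have u0 b N : (0 <= u b N)%E.
  by rewrite lee_fin mulr_ge0 ?invr_ge0// strip_entropy_ge0.
have sP b : sublinear (strip_entropy A b) <-> (u b @ \oo --> 0%E).
  by apply: sublinearP => N; exact: strip_entropy_ge0.
split => [h0 b b0|sA].
  apply/sP; apply: limn_esup_le_cvg => //.
  by rewrite -h0; apply: ereal_sup_ubound; exists b.
rewrite (_ : [set _ | _ in _] = [set 0%E]) ?ereal_sup1//.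
apply/seteqP; split => [_ [b /= b0 <-]|_ ->] /=.
  by have /sP/cvg_limn_einf_sup[_] := sA b b0.
by exists 1 => /=; [exact: ltr01|have /sP/cvg_limn_einf_sup[_] := sA 1 ltr01].
Qed.

Let q (i : nat) := torus_val (Defs.frac (beta *+ i)).

(** The shape of the path over [z.1]: the bit at [i] is true when the path passes through
    [floor (beta *+ i)], false when it passes one above. *)
Let coding N (z : torus R * X) := [ffun i : 'I_N => torus_val z.1 < 1 - q i].

Let coding_entropy N : measurable_label (@coding N) /\
  label_entropy mut (@coding N) <= ln N.+1%:R.
Proof.
have [] := label_entropy_torus_thresholds mu (fun i : 'I_N => 1 - q i).
by rewrite card_ord.
Qed.

Let floor_coding N (z : torus R * X) (i : 'I_N) :
  Num.floor (beta *+ i + torus_val z.1) =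
  Num.floor (beta *+ i) + ~~ (coding N z i) :> int.
Proof. by rewrite /coding ffunE; have [] := rotation_threshold beta z.1 i. Qed.

Let snd_preserving B : measurable B -> mut (snd @^-1` B) = mu B.
Proof.
move=> mB; rewrite (_ : snd @^-1` B = setT `*` B); last by apply/seteqP; split => [z Bz|z []].
transitivity (m setT * mu B)%E; first exact: product_measure1E.
by rewrite probability_setT mul1e.
Qed.

Let msnd (I : finType) (xi : X -> I) : measurable_label xi -> measurable_label (xi \o (@snd (torus R) X)).
Proof.
move=> mxi i; rewrite comp_preimage -[X in measurable X]setTI.
by apply: measurable_snd => //; exact: mxi.
Qed.

Lemma orbit_entropy_le_strip A N : measurable A ->
  orbit_entropy mut Theta (snd @^-1` A) N <= ln N.+1%:R + strip_entropy A 1 N.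
Proof.
move=> mA; have [I [e [eD ->]]] := strip_labels A 1 N.
have [mc cN] := coding_entropy N.
have me := mitin e mA.
(* Both possible heights, [floor (beta *+ i)] and its successor, lie within 1 of the line; this
   fixes the strip parameter 1. *)
have ex (p : 'I_N * bool) : exists j, e j = ((p.1)%:Z, Num.floor (beta *+ p.1) + p.2).
  have : strip_window beta 1 N ((p.1)%:Z, Num.floor (beta *+ p.1) + p.2).
    split; rewrite /strip/=; last by have := ltn_ord p.1; lia.
    have := floor_itv (beta *+ p.1); rewrite !intrD mulr_natr.
    by case: p.2 => /= /andP[? ?]; apply/andP; split; lra.
  by rewrite -eD => -[j _ <-]; exists j.
have [idx idxE] := choice ex.
pose phi (p : {ffun 'I_N -> bool} * {ffun I -> bool}) : {ffun 'I_N -> bool} :=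
  [ffun i => p.2 (idx (i, ~~ p.1 i))].
have mz := measurable_label_pair mc (msnd me).
have -> : orbit_entropy mut Theta (snd @^-1` A) N =
    label_entropy mut (phi \o (fun z => (coding N z, (itinerary (T \o e) A \o snd) z))).
  congr label_entropy; apply/funext => z; apply/ffunP => i; rewrite /phi.
  rewrite [LHS]ffunE [RHS]ffunE/= [RHS]ffunE/= idxE/= -floor_coding.
  by rewrite iter_twist//= natz.
apply: (le_trans (label_entropy_comp mut phi mz)).
apply: (le_trans (label_entropy_pair mut mc (msnd me))); apply: lerD => //.
by rewrite (label_entropy_preserving snd_preserving me).
Qed.

Lemma strip_entropy_le_orbit A b : measurable A -> exists J : nat, forall N,
  strip_entropy A b N <= ln N.+1%:R + J%:R * orbit_entropy mut Theta (snd @^-1` A) N.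
Proof.
(* A strip point is within [|b|] of the line, and the path [floor (beta *+ i + t)] is within 1 of
   it. As [K > |b| + 1], offsets from the path lie strictly between [- K] and [K], covered by
   [2 K + 1] translates. *)
move=> mA; pose K := (Num.truncn `|b|).+2.
exists (2 * K).+1 => N; have [I [e [eD ->]]] := strip_labels A b N.
have [mc cN] := coding_entropy N; have me := mitin e mA.
have KP : `|b| + 1 < K%:R by rewrite /K -natr1 ltrD2r truncnS_gt.
have mAt : measurable (snd @^-1` A : set (torus R * X)).
  by rewrite -[X in measurable X]setTI; exact: measurable_snd.
(* The vertical translation by [j - K], written as a twist so that it commutes with [Theta] and
   preserves the measure. *)
pose S (j : 'I_(2 * K).+1) := twist T 0 ((j%:Z - K%:Z)%:~R : R).
pose zeta (j : 'I_(2 * K).+1) := orbit_label Theta (snd @^-1` A) N \o S j.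
have mo : measurable_label (orbit_label Theta (snd @^-1` A) N).
  by apply: measurable_orbit_label mAt; exact: measurable_twist.
have mzeta j : measurable_label (zeta j).
  move=> g; rewrite /zeta comp_preimage -[X in measurable X]setTI.
  by apply: measurable_twist => //; exact: mo.
have mZ := measurable_label_ffun mzeta.
have mz := measurable_label_pair mc mZ.
(* The name at [(i, n)] is letter [i] of the translate indexed by the offset of [n] from the path,
   plus [K]. Window points have [0 <= i < N] and an offset in range, so neither [false] nor the
   default of [inord] is reached. *)
pose phi (p : {ffun 'I_N -> bool} * {ffun 'I_(2 * K).+1 -> {ffun 'I_N -> bool}}) : {ffun I -> bool} :=
  [ffun l => if (insub (absz (e l).1) : option 'I_N) is Some i then
     p.2 (inord (absz ((e l).2 - (Num.floor (beta *+ i) + ~~ p.1 i) + K%:Z)%R)) i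
   else false].
rewrite -(label_entropy_preserving snd_preserving me).
have -> : itinerary (T \o e) A \o snd =
    phi \o (fun z => (coding N z, [ffun j => zeta j z])).
  apply/funext => z; apply/ffunP => l; rewrite /phi [LHS]ffunE [RHS]ffunE/=.
  have : strip_window beta b N (e l) by rewrite -eD; exists l.
  case: (e l) => i n [/= /andP[h1 h2] /andP[i0 iN]].
  case: i i0 iN h1 h2 => //= i _ iN h1 h2.
  have iN' : (i < N)%N by lia.
  rewrite insubT -floor_coding/= !ffunE/=.
  set f := Num.floor (beta *+ i + _).
  have nf : (`|n - f| < K%:Z)%R.
    rewrite -(ltr_int R) intr_norm; apply: le_lt_trans KP.
    have := floor_itv (beta *+ i + torus_val z.1); rewrite -/f !intrD.
    have bi : beta * i%:~R = beta *+ i by rewrite -mulr_natr.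
    have /andP[t0 t1] := torus_valP z.1.
    move=> /andP[f1 f2]; have := ler_norm b.
    have := ler_norm (- b); rewrite normrN => ? ?.
    by rewrite ler_norml; apply/andP; split; lra.
  rewrite /S inordK; last by lia.
  have -> : ((absz (n - f + K%:Z)%R)%:Z - K%:Z) = n - f by lia.
  rewrite /Theta iter_twist// twistD//=; congr (`[< A (T (_, _) z.2) >]); first lia.
  by rewrite addrAC floorDrz ?intr_int// intrKfloor -/f; lia.
apply: (le_trans (label_entropy_comp mut phi mz)).
apply: (le_trans (label_entropy_pair mut mc mZ)); apply: lerD => //.
apply: (le_trans (label_entropy_ffun mut mzeta)).
rewrite (eq_bigr (fun=> orbit_entropy mut Theta (snd @^-1` A) N)); last first.
  move=> j _; apply: label_entropy_preserving mo.
  by move=> B mB; exact: twist_preserving.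
by rewrite sumr_const card_ord mulr_natl.
Qed.

Lemma directional_PinskerE (A : set X) :
  directional_Pinsker mu T beta A <-> zero_entropy mut Theta (snd @^-1` A).
Proof.
have mAt : measurable A -> measurable (snd @^-1` A : set (torus R * X)).
  by move=> mA; rewrite -[X in measurable X]setTI; exact: measurable_snd.
split => [[mA /(directional_entropy_eq0 mA) sA]|[mA' sA]].
  split; first exact: mAt.
  apply: sublinear_le (fun N => orbit_entropy_le_strip N mA) _.
  by apply: sublinearD; [exact: sublinear_ln|exact: sA].
have mA : measurable A.
  rewrite (_ : A = xsection (snd @^-1` A) (point : torus R)); first exact: measurable_xsection.
  by rewrite xsection_preimage_snd.
split=> //; apply/(directional_entropy_eq0 mA) => b b0.
have [J JP] := strip_entropy_le_orbit b mA.
apply: sublinear_le JP _; apply: sublinearD; first exact: sublinear_ln.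
apply: sublinear_le (sublinear_sum (nseq J tt) (fun=> sA)) => N.
by rewrite big_const_seq count_predT size_nseq iter_addr_0 mulr_natl.
Qed.

End directional.

(** * Sections of zero entropy sets *)

Section sections.
Context {R : realType} {d} {X : measurableType d} (mu : probability X R).
Variables (T : int * int -> X -> X).
Hypothesis mT : forall w, measurable_fun setT (T w).
Hypothesis T0 : T 0 = id.
Hypothesis TD : forall w u, T w \o T u = T (w + u).
Hypothesis Tmu : invariant_measure T mu.
Variable beta : R.
Let m : probability (torus R) R := @torus_measure R.
Let mut : probability (torus R * X)%type R := (m \x mu)%E.
Let Theta := twist T 1 beta.
Implicit Types E : set (torus R * X).

Lemma pr_torus_itv (a b : R) : a <= b ->
  pr mut ((@torus_val R \o fst) @^-1` `[a, b]) <= b - a.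
Proof.
move=> ab; rewrite comp_preimage; set C := _ @^-1` `[a, b].
have mC : measurable C by exists `[a, b]%classic => //; rewrite setTI.
rewrite (_ : fst @^-1` C = C `*` setT); last by apply/seteqP; split => [z Cz|z []].
rewrite prX// prT mulr1 -lee_fin -prE//.
have abE : lebesgue_measure (`[a, b]%classic : set R) = (b - a)%:E.
  rewrite lebesgue_measure_itv/= lte_fin; case: ltP => // ba.
  by rewrite (_ : b = a) ?subrr//; apply/le_anti; rewrite ab ba.
rewrite -abE; apply: le_measure; rewrite ?inE.
- exact: measurable_torus_val_image.
- exact: measurable_itv.
- by move=> _ [t Ct <-].
Qed.

(** Right continuity at time 0 is the form used: the times inserted later are ticks, which are
    nonnegative. *)
Let flow_continuous E := measurable E /\ forall e : R, 0 < e ->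
  exists2 r, 0 < r & forall u, 0 <= u <= r -> pr mut (E `+` twist T 0 u @^-1` E) <= e.

Let mpre u E : measurable E -> measurable (twist T 0 u @^-1` E).
Proof. by move=> mE; rewrite -[X in measurable X]setTI; exact: measurable_twist. Qed.

(** Membership can change only where the base crosses [c] or wraps around 1, that is, over two arcs
    of length [u]; hence [e / 2] in the choice of the radius. *)
Let flow_continuous_sub E (c : R) : measurable E ->
  (forall u z, 0 <= u <= 1 -> (E `+` twist T 0 u @^-1` E) z ->
    c - u <= torus_val z.1 <= c \/ 1 - u <= torus_val z.1 <= 1) ->
  flow_continuous E.
Proof.
move=> mE Esub; split=> // e e0; exists (Num.min 1 (e / 2)).
  by rewrite lt_min ltr01 divr_gt0.
move=> u /andP[u0]; rewrite le_min => /andP[u1 ue].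
have mI (a b : R) : measurable ((@torus_val R \o fst) @^-1` `[a, b] : set (torus R * X)).
  rewrite -[X in measurable X]setTI.
  by apply: (measurableT_comp measurable_torus_val).
apply: (@le_trans _ _ (pr mut ((@torus_val R \o fst) @^-1` `[c - u, c] `|`
    (@torus_val R \o fst) @^-1` `[1 - u, 1]))).
  apply: pr_le; [by apply: measurableY => //; exact: mpre|exact: measurableU|].
  move=> z Ez; have := Esub u z _ Ez; rewrite u0 u1 => /(_ isT).
  by rewrite /setU/= !in_itv.
apply: le_trans (prU_le _ _ _) _ => //.
have h1 : pr mut ((@torus_val R \o fst) @^-1` `[c - u, c]) <= c - (c - u).
  by apply: pr_torus_itv; lra.
have h2 : pr mut ((@torus_val R \o fst) @^-1` `[1 - u, 1]) <= 1 - (1 - u).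
  by apply: pr_torus_itv; lra.
lra.
Qed.

(** The continuous sets form a sigma-algebra, closed in measure because every [twist 0 u] preserves
    the measure. It contains the cylinders over [X], which change only at the wrap, and those over
    initial arcs of the torus. *)
Lemma flow_continuity E e : measurable E -> 0 < e ->
  exists2 r, 0 < r & forall u, 0 <= u <= r -> pr mut (E `+` twist T 0 u @^-1` E) <= e.
Proof.
move=> mE; move: e; suff : flow_continuous E by case.
have sK : sigma_algebra setT flow_continuous.
  apply: (@sigma_algebra_approx _ _ _ mut).
  - by move=> A [].
  - split => // e e0; exists 1 => // u _.
    by rewrite preimage_set0 setYK pr0 ltW.
  - move=> A [mA cA]; split; first exact: measurableC.
    by move=> e /cA[r r0 rP]; exists r => // u /rP; rewrite preimage_setC setYCC.
  - move=> A B [mA cA] [mB cB]; split; first exact: measurableU.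
    move=> e e0; have e20 : 0 < e / 2 by rewrite divr_gt0.
    have [r r0 rP] := cA _ e20; have [s s0 sP] := cB _ e20.
    exists (Num.min r s); first by rewrite lt_min r0 s0.
    move=> u /andP[u0]; rewrite le_min => /andP[ur us].
    have h1 := rP u; have h2 := sP u; rewrite u0 ur in h1; rewrite u0 us in h2.
    rewrite (splitr e); apply: le_trans (lerD (h1 isT) (h2 isT)).
    have mA' := measurableY mA (mpre u mA); have mB' := measurableY mB (mpre u mB).
    apply: le_trans (prU_le mut mA' mB'); apply: pr_le; last exact: setYUU.
      by apply: measurableY; [exact: measurableU|apply: mpre; exact: measurableU].
    exact: measurableU.
  - move=> A mA Ae; split=> // e e0; have e30 : 0 < e / 3 by rewrite divr_gt0.
    have [B [mB cB] AB] := Ae _ e30; have [r r0 rP] := cB _ e30.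
    exists r => // u /rP BB; have mA' := mpre u mA; have mB' := mpre u mB.
    have := prY_triangle mut mA mB mA'; have := prY_triangle mut mB mB' mA'.
    have -> : pr mut (twist T 0 u @^-1` B `+` twist T 0 u @^-1` A) = pr mut (A `+` B).
      by rewrite setYC /pr -(twist_preserving mT Tmu 0 u (measurableY mA mB)).
    lra.
have [K0 KC KU] := sK.
have val01 (t : torus R) (u : R) : 0 <= u <= 1 -> torus_val t < 1 - u ->
    Num.floor (u + torus_val t) = 0 /\ torus_val (rotation u t) = torus_val t + u.
  move=> /andP[u0 u1] tu; have /andP[t0 t1] := torus_valP t.
  have fl : Num.floor (u + torus_val t) = 0 by apply: floor_eq0; apply/andP; split; lra.
  by rewrite /rotation /= (addrC _ u) fl subr0.
have Ksnd B : measurable B -> flow_continuous (snd @^-1` B).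
  move=> mB; apply: (flow_continuous_sub (c := 1)).
    by rewrite -[X in measurable X]setTI; exact: measurable_snd.
  move=> u [t x] u01 zE; right; rewrite leNgt /=.
  have /andP[_ /ltW ->] := torus_valP t; rewrite andbT; apply/negP => tu.
  have [fl _] := val01 t u u01 tu.
  have EB : (twist T 0 u @^-1` (snd @^-1` B)) (t, x) = B x.
    by rewrite -[LHS]/(B (T (0, Num.floor (u + torus_val t)) x)) fl -[(0, 0)]/(0 : int * int) T0.
  by move: zE; rewrite /setY/setU/setD/mkset EB /=; tauto.
have Kfst C : measurable C -> flow_continuous (fst @^-1` C).
  move=> [B + <-]; rewrite setTI -comp_preimage.
  have -> : measurable B = <<s @RGenInftyO.G R >> B.
    exact: (congr1 (fun S => S B) (@RGenInftyO.measurableE R)).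
  apply: (@smallest_sub _ _ _ [set B | flow_continuous ((@torus_val R \o fst) @^-1` B)]).
    split; first by rewrite /= preimage_set0.
      by move=> A zA; rewrite setTD /= preimage_setC -setTD; exact: KC.
    by move=> F zF; rewrite /= preimage_bigcup; exact: KU.
  move=> _ [c ->] /=; apply: (flow_continuous_sub (c := c)).
    rewrite -[X in measurable X]setTI.
    by apply: (measurableT_comp measurable_torus_val).
  move=> u [t x] u01 zE; have /andP[t0 /ltW t1] := torus_valP t.
  have [tu|tu] := ltP (torus_val t) (1 - u); [left|by right; apply/andP].
  have [_ rt] := val01 t u u01 tu.
  have EB : (twist T 0 u @^-1` ((@torus_val R \o fst) @^-1` `]-oo, c[)) (t, x) =
      (torus_val t + u < c) :> Prop.
    by rewrite -rt -[LHS]/(is_true (torus_val (rotation u t) \in `]-oo, c[)) in_itv.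
  move: zE; rewrite /setY/setU/setD/mkset EB /= in_itv/=.
  by move=> [[tc /negP]|[tc /negP]]; rewrite -leNgt => ?; apply/andP; split; lra.
have : <<s [set A `*` B | A in measurable & B in measurable] >> E.
  by rewrite -measurable_prod_measurableType.
apply: smallest_sub => // _ [A mA [B mB <-]].
rewrite (_ : A `*` B = fst @^-1` A `&` snd @^-1` B)//.
by apply: (sigma_algebra_setI sK); [exact: Kfst|exact: Ksnd].
Qed.


(** The distance from [t] to the left end of its arc, in the division of the torus into [n.+1] equal
    arcs. *)
Let tick (n : nat) (t : torus R) : R :=
  torus_val t - (Num.floor (n.+1%:R * torus_val t))%:~R / n.+1%:R.

Let tick_itv n t : 0 <= tick n t <= n.+1%:R^-1.
Proof.
have n0 : 0 < n.+1%:R :> R by rewrite ltr0n.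
have := floor_itv (n.+1%:R * torus_val t); rewrite intrD /tick.
set k := _%:~R => /andP[h1 h2].
rewrite subr_ge0 ler_pdivrMr// mulrC h1/= lerBlDr.
have -> : n.+1%:R^-1 + k / n.+1%:R = (k + 1) / n.+1%:R by rewrite mulrDl mul1r addrC.
by rewrite ler_pdivlMr// mulrC ltW.
Qed.

Let measurable_tick n : measurable_fun setT (tick n).
Proof.
apply: measurable_funB; first exact: measurable_torus_val.
apply: measurable_funM; last exact: measurable_cst.
apply: (measurableT_comp measurable_floor); apply: measurable_funM => //.
exact: measurable_torus_val.
Qed.

(* [spread n t0 E] has the section [E_(t0 + tick n t)] at [t] (up to the
   identification of the two ends of the torus by [T (0, 1)]): for large [n] it
   is close to the cylinder over [E_t0]. *)
Let spread n (t0 : torus R) E : set (torus R * X) :=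
  [set z | E (twist T 0 (tick n z.1) (t0, z.2))].

Let zero_entropy_spread n t0 E :
  zero_entropy mut Theta E -> zero_entropy mut Theta (spread n t0 E).
Proof.
move=> zE; have [_ _ zU] := sigma_algebra_zero_entropy
  (measurable_twist mT 1 beta) (twist_preserving mT Tmu 1 beta).
(* On arc [k], moving [t0] by the tick of [t] is moving [t] by the constant time [t0 - k / n.+1], so
   the spread is there the preimage of [E] under one twist. *)
pose G (k : nat) := fst @^-1` [set t | Num.floor (n.+1%:R * torus_val t) = k] `&`
  twist T 0 (torus_val t0 - k%:R / n.+1%:R) @^-1` E.
have -> : spread n t0 E = \bigcup_k G k.
  have GE k (z : torus R * X) : Num.floor (n.+1%:R * torus_val z.1) = k%:Z ->
      twist T 0 (tick n z.1) (t0, z.2) = twist T 0 (torus_val t0 - k%:R / n.+1%:R) z.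
    move=> zk; rewrite /twist /rotation /tick zk /=.
    rewrite -[_%:~R]/(k%:R); congr pair; first by congr Defs.frac; ring.
    by congr (T (0, Num.floor _) _); ring.
  apply/seteqP; split => [z Ez|z [k _ [/= zk]]]; last by rewrite /spread/= -GE.
  have f0 : 0 <= Num.floor (n.+1%:R * torus_val z.1).
    by rewrite floor_ge_int mulr_ge0//; have /andP[] := torus_valP z.1.
  exists (absz (Num.floor (n.+1%:R * torus_val z.1))) => //.
  have zk : Num.floor (n.+1%:R * torus_val z.1) = absz (Num.floor (n.+1%:R * torus_val z.1)).
    by rewrite gez0_abs.
  by split => //=; rewrite -GE.
apply: zU => k; apply: zero_entropyI; first exact: measurable_twist.
- apply: zero_entropy_fst => //.
  rewrite -[X in measurable X]setTI.
  rewrite (_ : [set t | _] = (fun t => (Num.floor (n.+1%:R * torus_val t))%:~R : R) @^-1` [set k%:R]).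
    apply: (measurableT_comp measurable_floor) => //; apply: measurable_funM => //.
    exact: measurable_torus_val.
  apply/seteqP; split => t /= h; first by rewrite h.
  by apply: (@intr_inj R).
- exact: zero_entropy_twist.
Qed.

(** [delta n t0] is the distance between the cylinder over the section at [t0] and [spread n t0 E],
    which has zero entropy. Its mean over [t0] is small for large [n], so for almost every [t0] its
    infimum over [n] is 0 and the cylinder is a limit of zero-entropy sets. *)
Lemma ae_section_directional_Pinsker E : zero_entropy mut Theta E ->
  exists2 N, m.-negligible N & forall t, ~ N t -> directional_Pinsker mu T beta (xsection E t).
Proof.
move=> zE; have mE : measurable E by have [] := zE.
pose E1 : set ((torus R * torus R) * X) := [set p | E (p.1.1, p.2)].
pose E2 n : set ((torus R * torus R) * X) :=
  [set p | E (twist T 0 (tick n p.1.2) (p.1.1, p.2))].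
have m11 : measurable_fun setT (fun p : (torus R * torus R) * X => p.1.1).
  exact: measurableT_comp measurable_fst measurable_fst.
have m12 : measurable_fun setT (fun p : (torus R * torus R) * X => p.1.2).
  exact: measurableT_comp measurable_snd measurable_fst.
have mE1 : measurable E1.
  by rewrite -[X in measurable X]setTI; apply: (measurable_fun_pair m11 measurable_snd).
have mE2 n : measurable (E2 n).
  rewrite -[X in measurable X]setTI.
  apply: (measurable_fun_twist mT 0 (measurableT_comp (measurable_tick n) m12) m11 measurable_snd) => //.
pose W n := E1 `+` E2 n.
have mW n : measurable (W n) by exact: measurableY.
pose g n (p : torus R * torus R) := mu (xsection (W n) p).
have mg n : measurable_fun setT (g n) by exact: measurable_fun_xsection.
have g0 n p : (0 <= g n p)%E by exact: measure_ge0.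
pose delta n t0 := (\int[m]_t g n (t0, t))%E.
have mdelta n : measurable_fun setT (delta n).
  exact: (@measurable_fun_fubini_tonelli_F _ _ _ _ _ m (g n) (mg n) (g0 n)).
have delta0 n t0 : (0 <= delta n t0)%E by apply: integral_ge0.
have deltaE n t0 : delta n t0 = mut (snd @^-1` (xsection E t0) `+` spread n t0 E).
  apply: eq_integral => t _ /=; congr (mu _).
  apply/seteqP; split => x; rewrite /W.
    move=> /xsectionP[[h nh]|[h nh]]; apply/xsectionP; [left|right]; split => //.
    - exact/xsectionP.
    - by move=> /xsectionP.
  move=> /xsectionP[[/xsectionP h nh]|[h nh]]; apply/xsectionP; [left|right]; split => //.
  by move=> h'; apply: nh; apply/xsectionP.
have int_delta e : 0 < e -> exists n, (\int[m]_t0 delta n t0 <= e%:E)%E.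
  move=> e0; have [r r0 rP] := flow_continuity mE e0.
  exists (Num.truncn r^-1); set n := Num.truncn _.
  have nr : n.+1%:R^-1 <= r.
    by rewrite -[leRHS]invrK lef_pV2 ?posrE ?ltr0n ?invr_gt0// ltW// truncnS_gt.
  (* For fixed [t] the integral over [t0] compares [E] with its preimage under the twist by the
     constant time [tick n t], so [flow_continuity] applies. *)
  rewrite (@fubini_tonelli _ _ _ _ _ m m (g n) (mg n) (g0 n)).
  apply: (@le_trans _ _ (\int[m]_t e%:E)%E); last first.
    by rewrite integral_cst// [X in (_ * X)%E](probability_setT m) mule1.
  apply: ge0_le_integral => //.
  - by move=> t _; apply: integral_ge0.
  - exact: (@measurable_fun_fubini_tonelli_G _ _ _ _ _ m (g n) (mg n) (g0 n)).
  move=> t _; have /andP[k0 kn] := tick_itv n t.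
  have := rP (tick n t); rewrite k0 (le_trans kn nr) -lee_fin => /(_ isT).
  rewrite -(prE mut); last by apply: measurableY => //; exact: mpre.
  apply: le_trans; rewrite le_eqVlt; apply/orP; left; apply/eqP.
  apply: eq_integral => t0 _ /=; congr (mu _).
pose N j := \bigcap_n [set t0 | (j.+1%:R^-1%:E <= delta n t0)%E].
have mN j : measurable (N j).
  apply: bigcapT_measurable => n; rewrite -[X in measurable X]setTI.
  exact: emeasurable_fun_c_infty.
exists (\bigcup_j N j).
  apply: negligible_bigcup => j; apply/negligibleP => //.
  transitivity (pr m (N j))%:E; first exact: (prE m (mN j)).
  congr EFin; apply/le_anti; rewrite pr_ge0 andbT.
  apply/ler_addgt0Pr => e e0; rewrite add0r.
  have j0 : 0 < j.+1%:R^-1 :> R by rewrite invr_gt0 ltr0n.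
  (* Markov's inequality at level [1 / (j + 1)]: a mean at most [e / (j + 1)] leaves [N j] measure
     at most [e]. *)
  have [n nP] := int_delta _ (mulr_gt0 j0 e0).
  rewrite -(ler_pM2l j0) -lee_fin; apply: le_trans nP.
  have := @le_integral_abse _ _ _ m setT measurableT (delta n) (j.+1%:R^-1) (mdelta n) j0.
  under eq_integral do rewrite gee0_abs//.
  apply: le_trans; rewrite EFinM -(prE m (mN j)) lee_pmul2l//.
  apply: le_measure; rewrite ?inE//.
    apply: emeasurable_fun_c_infty => //; exact: measurableT_comp.
  by move=> t0 Nt0; split => //=; rewrite gee0_abs//; exact: Nt0.
move=> t0 nN; apply/(directional_PinskerE mT T0 TD Tmu).
have mEt : measurable (xsection E t0) by exact: measurable_xsection.
apply: (zero_entropy_closed (measurable_twist mT 1 beta) (twist_preserving mT Tmu 1 beta)).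
  by rewrite -[X in measurable X]setTI; exact: measurable_snd.
(* If no zero-entropy set were [e]-close to the cylinder, every spread would stay at distance at
   least [1 / (j + 1)] for a suitable [j], and [t0] would lie in [N j]. *)
move=> e e0; apply: contrapT => nB; apply: nN.
exists (Num.truncn e^-1) => // n _ /=; set j := Num.truncn _.
have je : j.+1%:R^-1 <= e.
  by rewrite -[leRHS]invrK lef_pV2 ?posrE ?ltr0n ?invr_gt0// ltW// truncnS_gt.
have zS := zero_entropy_spread n t0 zE.
apply: (@le_trans _ _ e%:E); first by rewrite lee_fin.
rewrite deltaE prE; last first.
  apply: measurableY; last by have [] := zS.
  by rewrite -[X in measurable X]setTI; exact: measurable_snd.
rewrite lee_fin leNgt; apply/negP => lte; apply: nB.
by exists (spread n t0 E) => //; exact: ltW.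
Qed.

Lemma sigma_algebra_directional_Pinsker :
  sigma_algebra setT (directional_Pinsker mu T beta).
Proof.
have [z0 zC zU] := sigma_algebra_zero_entropy (measurable_twist mT 1 beta)
  (twist_preserving mT Tmu 1 beta).
have PE := directional_PinskerE mT T0 TD Tmu beta.
split; first by apply/PE; rewrite preimage_set0.
  by move=> A /PE zA; apply/PE; rewrite setTD preimage_setC -setTD; exact: zC.
by move=> F zF; apply/PE; rewrite preimage_bigcup; apply: zU => n; exact/PE.
Qed.

Lemma product_sub_zero_entropy :
  product_sigma_algebra (@measurable _ (torus R)) (directional_Pinsker mu T beta) `<=`
  zero_entropy mut Theta.
Proof.
apply: smallest_sub.
  exact: (sigma_algebra_zero_entropy (measurable_twist mT 1 beta) (twist_preserving mT Tmu 1 beta)).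
move=> _ [A mA [B PB <-]]; rewrite (_ : A `*` B = fst @^-1` A `&` snd @^-1` B)//.
apply: zero_entropyI; first exact: measurable_twist.
- exact: zero_entropy_fst.
- exact/(directional_PinskerE mT T0 TD Tmu).
Qed.

Lemma zero_entropy_product_approx E : zero_entropy mut Theta E ->
  exists2 B, product_sigma_algebra (@measurable _ (torus R)) (directional_Pinsker mu T beta) B &
    mut.-negligible (E `+` B).
Proof.
move=> zE; have mE : measurable E by have [] := zE.
have [N Nn NP] := ae_section_directional_Pinsker zE.
apply: negligible_approx => //.
- exact: smallest_sigma_algebra.
- by move=> B /product_sub_zero_entropy[].
- move=> e e0; apply: (@step_set_section_approx _ _ _ _ _ m mu _ N E e _ _ Nn mE NP e0).
    by move=> A [].
  by have [] := sigma_algebra_directional_Pinsker.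
Qed.

End sections.

(** * Conditional expectations *)

Section conditional_expectation.
Context {R : realType} {d} {Z : measurableType d} (mu : probability Z R).
Variable F : set (set Z).
Hypothesis sF : sigma_algebra setT F.
Hypothesis mF : F `<=` measurable.

Lemma sigma_algebra_completion : sigma_algebra setT (completion mu F).
Proof.
have [F0 FC FU] := sF; split.
- by exists set0 => //; rewrite setYK; exact: negligible_set0.
- move=> A [B FB nAB]; exists (setT `\` B); first exact: FC.
  by rewrite !setTD setYCC.
- move=> A Acompl; have /choice[B /all_and2[FB nB]] : forall n, exists B,
      F B /\ mu.-negligible (A n `+` B).
    by move=> n; have [B FB nB] := Acompl n; exists B.
  exists (\bigcup_n B n); first exact: FU.
  apply: negligibleS (negligible_bigcup nB) => z; rewrite setY_def.
  move=> [[[n _ An] nBz]|[[n _ Bn] nAz]]; exists n => //; [left|right]; split => //.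
    by move=> Bn; apply: nBz; exists n.
  by move=> An; apply: nAz; exists n.
Qed.

Lemma integral_setY_negligible (u : Z -> \bar R) A B :
  measurable A -> measurable B -> measurable_fun setT u ->
  mu.-negligible (A `+` B) -> (\int[mu]_(x in A) u x = \int[mu]_(x in B) u x)%E.
Proof.
move=> mA mB mu_ nAB; rewrite integral_mkcond [RHS]integral_mkcond.
apply: ae_eq_integral => //.
- by apply: (measurable_restrictT u mA).1; exact: measurable_funTS.
- by apply: (measurable_restrictT u mB).1; exact: measurable_funTS.
apply: negligibleS nAB => z /= nz; apply: contrapT => nY; apply: nz => _.
rewrite !patchE; have [Az|nAz] := pselect (A z); have [Bz|nBz] := pselect (B z).
- by rewrite !mem_set.
- by exfalso; apply: nY; left.
- by exfalso; apply: nY; right.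
- by rewrite !memNset.
Qed.

(** The set where [h < g] lies only in the completion of [F], whereas the integrals are prescribed
    on [F]; a member of [F] differing from it by a null set is substituted. On it [g - h] is
    positive and has integral 0. *)
Let lt_negligible (f g h : Z -> R) : cond_exp_version mu F f g ->
  cond_exp_version mu F f h -> mu.-negligible [set z | h z < g z].
Proof.
move=> [ig cg gf] [ih ch hf]; set U := [set z | _].
have mg : measurable_fun setT (EFin \o g) by exact: measurable_int ig.
have mh : measurable_fun setT (EFin \o h) by exact: measurable_int ih.
have mU : measurable U.
  rewrite (_ : U = setT `&` [set z | ((EFin \o h) z < (EFin \o g) z)%E]).
    exact: emeasurable_fun_lt.
  by rewrite setTI; apply/seteqP; split => z; rewrite /= lte_fin.
have [B FB UB] : completion mu F U.
  rewrite (_ : U = \bigcup_(r : rat) (h @^-1` `]-oo, ratr r[ `&` g @^-1` `]ratr r, +oo[)).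
    apply: sigma_algebra_countable_bigcup => [|r]; first exact: sigma_algebra_completion.
    by apply: sigma_algebra_setI; [exact: sigma_algebra_completion|exact: ch|exact: cg].
  apply/seteqP; split => [z /rat_in_itvoo[r]|z [r _ []]] /=; rewrite !in_itv/= ?andbT.
    by move=> /andP[hr rg]; exists r => //=; rewrite !in_itv/= andbT.
  exact: lt_trans.
have mB := mF FB.
have gh : (\int[mu]_(x in U) (g x)%:E = \int[mu]_(x in U) (h x)%:E)%E.
  rewrite (integral_setY_negligible mU mB mg UB) gf// -hf//.
  by rewrite (integral_setY_negligible mU mB mh UB).
have iUg : mu.-integrable U (EFin \o g) by exact: integrableS ig.
have iUh : mu.-integrable U (EFin \o h) by exact: integrableS ih.
have int0 : (\int[mu]_(x in U) `|(g x)%:E - (h x)%:E| = 0)%E.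
  transitivity (\int[mu]_(x in U) ((g x)%:E - (h x)%:E))%E.
    apply: eq_integral => z; rewrite inE => Uz.
    by rewrite gee0_abs// -EFinB lee_fin subr_ge0 ltW.
  rewrite integralB_EFin// gh subee//; exact: integrable_fin_num.
have mgh : measurable_fun U (fun x => ((g x)%:E - (h x)%:E)%E).
  by apply: emeasurable_funB; [exact: measurable_int iUg|exact: measurable_int iUh].
have := (ae_eq_integral_abs mu mU mgh).1 int0.
apply: negligibleS => z Uz /= /(_ Uz)/eqP.
by rewrite -EFinB eqe subr_eq0 gt_eqF.
Qed.

Lemma cond_exp_version_unique (f g h : Z -> R) : cond_exp_version mu F f g ->
  cond_exp_version mu F f h -> {ae mu, forall z, g z = h z}.
Proof.
move=> fg fh; apply: negligibleS (negligibleU (lt_negligible fg fh) (lt_negligible fh fg)).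
by move=> z /= /eqP; rewrite neq_lt => /orP[?|?]; [right|left].
Qed.

End conditional_expectation.

(** * Conditional expectations on products *)

Section product_conditional_expectation.
Context {R : realType} {d1 d2} {T : measurableType d1} {X : measurableType d2}.
Variables (m : probability T R) (mu : probability X R).
Let mut : probability (T * X)%type R := (m \x mu)%E.

(** Versions test integrals on the family itself, not on its completion; this carries them from the
    product sigma-algebra to the Pinsker algebra. *)
Lemma cond_exp_version_completion (F G : set (set (T * X))) (f g : T * X -> R) :
  F `<=` measurable -> G `<=` measurable -> completion mut F = completion mut G ->
  measurable_fun setT (EFin \o f) ->
  cond_exp_version mut F f g -> cond_exp_version mut G f g.
Proof.
move=> mF mG FG mf [ig cg gf]; split => //; first by move=> Y mY; rewrite -FG; exact: cg.
move=> A GA; have [B FB AB] : completion mut F A.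
  by rewrite FG; exists A; rewrite ?setYK//; exact: negligible_set0.
have mA := mG _ GA; have mB := mF _ FB.
rewrite (integral_setY_negligible mA mB (measurable_int _ ig) AB) gf//.
by rewrite (integral_setY_negligible mA mB mf AB).
Qed.

Lemma negligible_snd (N : set X) : mu.-negligible N ->
  mut.-negligible (snd @^-1` N : set (T * X)).
Proof.
move=> [B [mB B0 NB]]; exists (setT `*` B); split.
- exact: measurableX.
- transitivity (m setT * mu B)%E; first exact: product_measure1E.
  by rewrite (_ : mu B = 0%E) ?mule0//; exact: B0.
- by move=> z Nz; split => //; exact: NB.
Qed.

Variable P : set (set X).
Hypothesis sP : sigma_algebra setT P.
Hypothesis mP : P `<=` measurable.
Let prodP := product_sigma_algebra (@measurable _ T) P.

Let sprodP : sigma_algebra setT prodP.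
Proof. exact: smallest_sigma_algebra. Qed.

Let PT : P setT.
Proof. by have [P0 PC _] := sP; rewrite -(setD0 setT); exact: PC. Qed.

Let prodPX A B : measurable A -> P B -> prodP (A `*` B).
Proof. by move=> mA PB; apply: sub_sigma_algebra; exists A => //; exists B. Qed.

Lemma product_sigma_algebra_measurable : prodP `<=` measurable.
Proof.
apply: smallest_sub; first exact: sigma_algebra_measurable.
by move=> _ [A mA [B PB <-]]; apply: measurableX => //; exact: mP.
Qed.

Lemma measurable_fun_prodM (u : T -> R) (v : X -> R) :
  measurable_fun setT u -> measurable_fun setT v ->
  measurable_fun setT (fun z : T * X => u z.1 * v z.2).
Proof.
move=> mu_ mv; apply: measurable_funM.
  exact: measurableT_comp mu_ measurable_fst.
exact: measurableT_comp mv measurable_snd.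
Qed.

Lemma integrable_indic_prod C (g : X -> R) : measurable C ->
  mu.-integrable setT (EFin \o g) ->
  mut.-integrable setT (EFin \o (fun z : T * X => \1_C z.1 * g z.2)).
Proof.
move=> mC ig; have mg : measurable_fun setT g.
  by apply/measurable_EFinP; exact: measurable_int ig.
have mh : measurable_fun setT (EFin \o (fun z : T * X => \1_C z.1 * g z.2)).
  by apply/measurable_EFinP; apply: measurable_fun_prodM => //; exact: measurable_indic.
apply/(integrable12ltyP m mu mh).
have I1 : (\int[mu]_x `|(g x)%:E| < +oo)%E by have /integrableP[] := ig.
apply: le_lt_trans I1; rewrite -[leRHS]mule1 -(probability_setT m) -integral_cst//.
apply: ge0_le_integral => //.
- by move=> t _; exact: integral_ge0.
- apply: (@measurable_fun_fubini_tonelli_F _ _ _ _ _ mu (abse \o (EFin \o _))) => [|z].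
    exact: measurableT_comp mh.
  exact: abse_ge0.
move=> t _; apply: ge0_le_integral => //.
- by apply: measurableT_comp => //; exact: measurable_fun_pair2 mh.
- by apply: measurableT_comp => //; exact: measurable_int ig.
move=> x _; rewrite /= lee_fin normrM indicE.
by case: (_ \in _); rewrite ?normr1 ?mul1r// normr0 mul0r.
Qed.

Lemma integral_indic_prod C (g : X -> R) A B : measurable C ->
  mu.-integrable setT (EFin \o g) -> measurable A -> measurable B ->
  (\int[mut]_(z in A `*` B) (\1_C z.1 * g z.2)%:E =
   m (C `&` A) * \int[mu]_(x in B) (g x)%:E)%E.
Proof.
move=> mC ig mA mB.
have iBg : mu.-integrable setT (EFin \o (fun x => g x * \1_B x)).
  apply: le_integrable (ig) => //.
    apply/measurable_EFinP; apply: measurable_funM; last exact: measurable_indic.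
    by apply/measurable_EFinP; exact: measurable_int ig.
  move=> x _; rewrite /= lee_fin normrM indicE.
  by case: (_ \in _); rewrite ?normr1 ?mulr1// normr0 mulr0.
rewrite integral_mkcond.
transitivity (\int[mut]_z (\1_(C `&` A) z.1 * (g z.2 * \1_B z.2))%:E)%E.
  apply: eq_integral => -[t x] _; rewrite patchE/= in_setX/= !indicE in_setI.
  by case: (t \in A); case: (x \in B); case: (t \in C); rewrite /= ?(mulr0, mul0r, mulr1, mul1r).
have mCA : measurable (C `&` A) by exact: measurableI.
rewrite -(integral12_prod_meas1 (integrable_indic_prod mCA iBg)) /fubini_F/=.
transitivity (\int[m]_t ((\1_(C `&` A) t)%:E * \int[mu]_(x in B) (g x)%:E))%E.
  apply: eq_integral => t _.
  under eq_integral do rewrite EFinM.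
  rewrite integralZl//; congr (_ * _)%E; rewrite [RHS]integral_mkcond.
  apply: eq_integral => x _; rewrite patchE indicE.
  by case: (x \in B); rewrite ?mulr1 ?mulr0.
have fB : (\int[mu]_(x in B) (g x)%:E)%E \is a fin_num.
  by apply: integrable_fin_num => //; exact: integrableS ig.
rewrite -(fineK fB) integralZr//.
  by rewrite integral_indic// setIT.
exact: integrable_indic.
Qed.

(** The indicator of [C] is measurable for the conditioning family and factors out, leaving an
    expectation under [mu] alone. On rectangles this is Fubini; the pi-lambda theorem does the
    rest. *)
Lemma cond_exp_version_product C D (g : X -> R) : measurable C -> measurable D ->
  cond_exp_version mu P \1_D g ->
  cond_exp_version mut prodP \1_(C `*` D) (fun z => \1_C z.1 * g z.2).
Proof.
move=> mC mD [ig cg gD]; have ih := integrable_indic_prod mC ig.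
have mprod := product_sigma_algebra_measurable.
split => //.
- move=> Y mY; have sc := sigma_algebra_completion mut sprodP.
  have fstc A : measurable A -> completion mut prodP (A `*` setT).
    move=> mA; exists (A `*` setT); first exact: prodPX.
    by rewrite setYK; exact: negligible_set0.
  have sndc : completion mut prodP (snd @^-1` (g @^-1` Y)).
    have [B PB nB] := cg Y mY; exists (setT `*` B); first exact: prodPX.
    apply: negligibleS (negligible_snd nB) => z.
    by move=> [[gz nB']|[[_ Bz] ngz]]; [left|right]; split => // Bz; apply: nB'.
  (* Over [C] the function is [g]; off [C] it is 0, so that part is everything or nothing according
     to whether [Y] contains 0. *)
  rewrite (_ : _ @^-1` Y = \bigcup_(b : bool) (if b then (C `*` setT) `&` (snd @^-1` (g @^-1` Y))
      else (~` C `&` [set _ | Y 0]) `*` setT)).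
    apply: sigma_algebra_countable_bigcup => // -[].
      by apply: sigma_algebra_setI => //; exact: fstc.
    apply: fstc; apply: measurableI; first exact: measurableC.
    have [Y0|nY0] := pselect (Y 0).
      by rewrite (_ : [set _ | _] = setT)//; apply/seteqP; split.
    by rewrite (_ : [set _ | _] = set0)//; apply/seteqP; split.
  apply/seteqP; split => [[t x] /=|[t x] [[] _ /=]].
  + rewrite indicE; have [Ct|nCt] := pselect (C t).
      by rewrite mem_set// mul1r => gY; exists true.
    by rewrite memNset// mul0r => Y0; exists false.
  + by move=> [[Ct _] gY]; rewrite indicE mem_set// mul1r.
  + by move=> [[nCt Y0] _]; rewrite indicE memNset// mul0r.
- pose f : T * X -> R := \1_(C `*` D); pose h (z : T * X) := \1_C z.1 * g z.2.
  have mCD : measurable (C `*` D) by exact: measurableX.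
  have if_ : mut.-integrable setT (EFin \o f) by exact: integrable_indic.
  pose K : set (set (T * X)) := [set A | measurable A /\
    (\int[mut]_(x in A) (h x)%:E = \int[mut]_(x in A) (f x)%:E)%E].
  have KX A B : measurable A -> P B -> K (A `*` B).
    move=> mA PB; have mB := mP PB; split; first exact: measurableX.
    rewrite integral_indic_prod// gD// !integral_indic//; last exact: measurableX.
    by rewrite -setXI [RHS]product_measure1E//; exact: measurableI.
  suff : prodP `<=` K by move=> pK A /pK[].
  apply: lambda_system_subset => //.
  + move=> _ _ [A mA [B PB <-]] [A' mA' [B' PB' <-]].
    rewrite -setXI; exists (A `&` A'); first exact: measurableI.
    by exists (B `&` B') => //; exact: sigma_algebra_setI.
  + apply/dynkin_lambda_system; split.
    * by rewrite -setXTT; exact: KX.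
    * move=> A [mA hA]; split; first exact: measurableC.
      have cE u : mut.-integrable setT u ->
          (\int[mut]_(x in ~` A) u x = \int[mut]_x u x - \int[mut]_(x in A) u x)%E.
        move=> iu; rewrite -[X in (\int[_]_(x in X) _ - _)%E](setUv A).
        rewrite integral_setU//; last 3 first.
        - exact: measurableC.
        - by rewrite setUv; exact: measurable_int iu.
        - by apply/disj_set2P; rewrite setICr.
        rewrite addeC addeA (addeC (- _)%E) subee ?add0e//.
        by apply: integrable_fin_num => //; exact: integrableS iu.
      rewrite !cE//; congr (_ - _)%E; last exact: hA.
      by have [] := KX _ _ measurableT PT; rewrite setXTT.
    * move=> A tA KA; have mA n : measurable (A n) by have [] := KA n.
      have mUA : measurable (\bigcup_n A n) by exact: bigcupT_measurable.
      split => //; rewrite !integral_bigcup//; last 2 first.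
        exact: integrableS if_.
        exact: integrableS ih.
      by congr (limn _); apply/funext => n; apply: eq_bigr => i _; have [] := KA i.
  + by move=> _ [A mA [B PB <-]]; exact: KX.
Qed.

End product_conditional_expectation.

(** * Countable generating pi-systems *)

Section countable_generation.

(** The generators contain [setT] so that cylinders over generating sets are themselves rectangles
    of the family. *)
Lemma measurable_prod_generated d1 d2 (T1 : measurableType d1) (T2 : measurableType d2)
    (G1 : set (set T1)) (G2 : set (set T2)) :
  measurable = <<s G1 >> -> measurable = <<s G2 >> -> G1 setT -> G2 setT ->
  @measurable _ (T1 * T2)%type = <<s [set A `*` B | A in G1 & B in G2] >>.
Proof.
move=> mG1 mG2 G1T G2T; rewrite measurable_prod_measurableType; set G := [set A `*` B | A in G1 & B in G2].
have sG : sigma_algebra setT <<s G >> by exact: smallest_sigma_algebra.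
have [G0 GC GU] := sG.
apply/seteqP; split; last first.
  apply: smallest_sub; first exact: smallest_sigma_algebra.
  move=> _ [A GA [B GB <-]]; apply: sub_sigma_algebra; exists A.
    by rewrite mG1; exact: sub_sigma_algebra.
  by exists B => //; rewrite mG2; exact: sub_sigma_algebra.
apply: smallest_sub => // _ [A + [B + <-]]; rewrite mG1 mG2 => sA sB.
rewrite (_ : A `*` B = fst @^-1` A `&` snd @^-1` B)//.
apply: (sigma_algebra_setI sG).
- move: sA; apply: (@smallest_sub _ _ _ [set A | <<s G >> (fst @^-1` A)]).
    split; first by rewrite /= preimage_set0.
      by move=> C GC'; rewrite setTD /= preimage_setC -setTD; exact: GC.
    by move=> F GF; rewrite /= preimage_bigcup; exact: GU.
  move=> C GC' /=; apply: sub_sigma_algebra; exists C => //; exists setT => //.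
  by apply/seteqP; split => [z []//|z Cz].
- move: sB; apply: (@smallest_sub _ _ _ [set B | <<s G >> (snd @^-1` B)]).
    split; first by rewrite /= preimage_set0.
      by move=> C GC'; rewrite setTD /= preimage_setC -setTD; exact: GC.
    by move=> F GF; rewrite /= preimage_bigcup; exact: GU.
  move=> C GC' /=; apply: sub_sigma_algebra; exists setT => //; exists C => //.
  by apply/seteqP; split => [z []//|z Cz].
Qed.

(** Countability lets one null set serve all rectangles, closure under intersection gives uniqueness
    of measures, and [setT] is used to generate products. *)
Definition countable_pi_generator d (T : measurableType d) (G : nat -> set T) :=
  [/\ measurable = <<s range G >>, setI_closed (range G) & range G setT].

Lemma countable_pi_generator_torus (R : realType) :
  exists G : nat -> set (torus R), countable_pi_generator G.
Proof.
(* Codes of no rational decode to 2. Since 2 exceeds all values of [torus_val], this rational also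
   yields [setT]. *)
pose r (k : nat) : rat := odflt 2 (unpickle k).
have rK q : r (pickle q) = q by rewrite /r pickleK.
pose G k : set (torus R) := @torus_val R @^-1` `]-oo, ratr (r k)[.
have GE (q : rat) : G (pickle q) = @torus_val R @^-1` `]-oo, ratr q[ by rewrite /G rK.
exists G; split.
- have [G0 GC GU] := @smallest_sigma_algebra _ setT (range G).
  apply/seteqP; split; last first.
    apply: smallest_sub; first exact: sigma_algebra_measurable.
    by move=> _ [k _ <-]; exists (`]-oo, ratr (r k)[%classic : set R) => //; rewrite setTI.
  move=> _ [B + <-]; rewrite setTI.
  have -> : measurable B = <<s @RGenInftyO.G R >> B.
    exact: (congr1 (fun S => S B) (@RGenInftyO.measurableE R)).
  apply: (@smallest_sub _ _ _ [set B | <<s range G >> (@torus_val R @^-1` B)]).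
    split; first by rewrite /= preimage_set0.
      by move=> C GC'; rewrite setTD /= preimage_setC -setTD; exact: GC.
    by move=> F GF; rewrite /= preimage_bigcup; exact: GU.
  move=> _ [c ->] /=.
  rewrite (_ : _ @^-1` _ = \bigcup_(q : rat) (if (ratr q : R) <= c then G (pickle q) else set0)).
    apply: sigma_algebra_countable_bigcup => [|q]; first exact: smallest_sigma_algebra.
    by case: ifP => // _; apply: sub_sigma_algebra; exists (pickle q).
  apply/seteqP; split => t /=; rewrite ?in_itv/=.
    move=> /rat_in_itvoo[q]; rewrite in_itv/= => /andP[tq qc].
    by exists q => //; rewrite ltW// GE /= in_itv.
  move=> [q _]; case: ifPn => // qc; rewrite GE /= in_itv/= => tq.
  exact: lt_le_trans qc.
- move=> _ _ [k _ <-] [l _ <-]; exists (pickle (Order.min (r k) (r l))) => //.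
  rewrite GE; apply/seteqP; split => t; rewrite /G /setI /= !in_itv/=.
    rewrite /Order.min; case: ifPn => [kl|]; last rewrite -leNgt => kl.
      by move=> tk; split => //; apply: lt_trans tk _; rewrite ltr_rat.
    by move=> tk; split => //; apply: lt_le_trans tk _; rewrite ler_rat.
  by move=> [tk tl]; rewrite /Order.min; case: ifP.
- exists (pickle (2 : rat)) => //; rewrite GE; apply/seteqP; split => // t _ /=.
  rewrite in_itv/=; have /andP[_ t1] := torus_valP t.
  by rewrite (lt_trans t1)// rmorph_nat ltr1n.
Qed.

(** Finite intersections of base sets, indexed by lists: concatenating lists intersects the sets,
    and the empty list gives [setT]. *)
Lemma countable_pi_generator_borel (X : ptopologicalType) : @second_countable X ->
  exists G : nat -> set (borel X), countable_pi_generator G.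
Proof.
move=> [B /countable_injP[f finj] [Bo Bb]].
have [b bB] : exists b : nat -> set X, (forall k, open (b k)) /\
    forall U, B U -> exists k, b k = U.
  (* Indices that number no base set are sent to [setT], which is open. *)
  exists (fun k => xget setT [set U | B U /\ f U = k]); split => [k|U BU].
    by case: xgetP => [U _ [/Bo]|_] //; exact: openT.
  exists (f U); case: xgetP => [V _ [BV fV]|/(_ U)]; last by case.
  by apply: finj; rewrite ?inE.
pose I (s : seq nat) : set X := \bigcap_(k in [set` s]) b k.
pose G k : set (borel X) := I (odflt [::] (unpickle k)).
have GE s : G (pickle s) = I s by rewrite /G pickleK.
have Iopen s : open (I s).
  elim: s => [|k s ih].
    by rewrite (_ : I [::] = setT); [exact: openT|apply/seteqP; split => // x _ i].
  rewrite (_ : I (k :: s) = b k `&` I s); first by apply: openI => //; exact: (proj1 bB).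
  apply/seteqP; split => [x Ix|x [bx Ix] i /=].
    by split => [|i /= si]; apply: Ix; rewrite /= inE ?eqxx// si orbT.
  by rewrite inE => /orP[/eqP->//|]; exact: Ix.
exists G; split.
- apply/seteqP; split.
    apply: smallest_sub; first exact: smallest_sigma_algebra.
    move=> U oU.
    rewrite (_ : U = \bigcup_k (if `[<b k `<=` U>] then G (pickle [:: k]) else set0)).
      apply: sigma_algebra_countable_bigcup => [|k]; first exact: smallest_sigma_algebra.
      case: ifP => _; first by apply: sub_sigma_algebra; exists (pickle [:: k]).
      by have [] := @smallest_sigma_algebra _ setT (range G).
    have I1 k : I [:: k] = b k.
      apply/seteqP; split => [x Ix|x bx i /=]; first by apply: Ix; rewrite /= inE.
      by rewrite inE => /eqP->.
    apply/seteqP; split => [x Ux|x [k _]]; last first.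
      by case: asboolP => // bU; rewrite GE I1; exact: bU.
    have [|V [BV Vx] VU] := Bb x U; first exact: open_nbhs_nbhs.
    have [k bk] := (proj2 bB) V BV; exists k => //; rewrite GE I1 bk.
    by case: asboolP.
  apply: smallest_sub; first exact: sigma_algebra_measurable.
  by move=> _ [k _ <-]; apply: sub_sigma_algebra; exact: Iopen.
- move=> _ _ [k _ <-] [l _ <-]; pose s : seq nat := odflt [::] (unpickle k); pose t : seq nat := odflt [::] (unpickle l).
  exists (pickle (s ++ t)) => //; rewrite GE /G -/s -/t /I -bigcap_setU.
  congr (\bigcap_(i in _) b i); apply/seteqP; split => i /=; rewrite mem_cat => /orP//.
- exists (pickle ([::] : seq nat)) => //; rewrite GE /I.
  by apply/seteqP; split => // x _ i.
Qed.

End countable_generation.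

(** * Disintegrations *)

Section disintegration.
Context {R : realType} {d1 d2} {T : measurableType d1} {X : measurableType d2}.
Variables (m : probability T R) (mu : probability X R).
Let mut : probability (T * X)%type R := (m \x mu)%E.
Variables (P : set (set X)) (Q : set (set (T * X))).
Hypothesis sP : sigma_algebra setT P.
Hypothesis mP : P `<=` measurable.
Hypothesis sQ : sigma_algebra setT Q.
Hypothesis mQ : Q `<=` measurable.
Hypothesis PQ : completion mut (product_sigma_algebra (@measurable _ T) P) = completion mut Q.
Variables (mu_ : X -> pprobability X R) (mut_ : T * X -> pprobability (T * X)%type R).
Hypothesis dmu : disintegration mu P mu_.
Hypothesis dmut : disintegration mut Q mut_.

Lemma disintegration_rectangle C D : measurable C -> measurable D ->
  {ae mut, forall z, mut_ z (C `*` D) = (\d_(z.1) \x mu_ z.2)%E (C `*` D)}.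
Proof.
move=> mC mD; have mCD : measurable (C `*` D) by exact: measurableX.
have [g1 g1D g1E] := dmu.2 \1_D (integrable_indic mu mD).
have [g gCD gE] := dmut.2 \1_(C `*` D) (integrable_indic mut mCD).
have hCD : cond_exp_version mut Q \1_(C `*` D) (fun z => \1_C z.1 * g1 z.2).
  apply: cond_exp_version_completion PQ _ (cond_exp_version_product m sP mP mC mD g1D) => //.
    exact: product_sigma_algebra_measurable.
  by apply/measurable_EFinP; exact: measurable_indic.
have gh := cond_exp_version_unique sQ mQ gCD hCD.
have g1E' := negligible_snd m g1E.
apply: negligibleS (negligibleU gE (negligibleU gh g1E')) => z /= nz.
apply: contrapT => /not_orP[/contrapT gz /not_orP[/contrapT ghz /contrapT g1z]].
apply: nz; move: gz g1z; rewrite ghz !integral_indic// !setIT => <- g1z.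
rewrite [RHS]product_measure1E//= diracE -[X in (_ * X)%E]g1z indicE.
by rewrite EFinM.
Qed.

(** The exceptional set must be chosen before [A]. It is the union of those of countably many
    rectangles; off it, two measures agree on a generating pi-system. *)
Lemma disintegration_product (G1 : nat -> set T) (G2 : nat -> set X) :
  countable_pi_generator G1 -> countable_pi_generator G2 ->
  {ae mut, forall z, forall A : set (T * X), measurable A ->
     mut_ z A = (\d_(z.1) \x mu_ z.2)%E A}.
Proof.
move=> [mG1 G1I G1T] [mG2 G2I G2T].
have mG1k k : measurable (G1 k) by rewrite mG1; apply: sub_sigma_algebra; exists k.
have mG2k k : measurable (G2 k) by rewrite mG2; apply: sub_sigma_algebra; exists k.
have : {ae mut, forall z, forall k l,
    mut_ z (G1 k `*` G2 l) = (\d_(z.1) \x mu_ z.2)%E (G1 k `*` G2 l)}.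
  by apply: ae_foralln => k; apply: ae_foralln => l; exact: disintegration_rectangle.
apply: filterS => z zG A mA.
apply: (measure_unique [set A `*` B | A in range G1 & B in range G2] (fun=> setT)) => //.
- exact: measurable_prod_generated.
- move=> _ _ [A1 GA1 [B1 GB1 <-]] [A2 GA2 [B2 GB2 <-]].
  by rewrite -setXI; exists (A1 `&` A2); [exact: G1I|exists (B1 `&` B2) => //; exact: G2I].
- by move=> _; exists setT => //; exists setT => //; rewrite setXTT.
- by apply/seteqP; split => // x _; exists 0%N.
- by move=> _ [_ [k _ <-] [_ [l _ <-] <-]]; exact: zG.
- by move=> _; rewrite (le_lt_trans (probability_le1 _ _))// ltry.
Qed.

End disintegration.

(** * Assembly for the Borel sigma-algebra of a compact metric space *)

Lemma measurable_fun_borel (X : ptopologicalType) (f : X -> X) : continuous f ->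
  measurable_fun setT (f : borel X -> borel X).
Proof.
move=> cf; apply: (@measurability _ _ (borel X) (borel X) setT f (@open X)) => // _ [U oU <-].
by rewrite setTI; apply: sub_sigma_algebra; apply: open_comp => // x _; exact: cf.
Qed.

Theorem theorem3p4 (R : realType) (X : pmetricType R)
    (T : int * int -> X -> X) (mu : probability (borel X) R) (beta : R) :
  compact [set: X] ->
  Z2_action T ->
  @invariant_measure R _ (borel X) T mu ->
  irrational beta ->
  let P := @directional_Pinsker R _ (borel X) mu T beta in
  let mut := (@torus_measure R \x mu)%E in
  let Theta := @skew_product R (borel X) T beta in
  let Pt := Pinsker mut Theta in
  completion mut (product_sigma_algebra (@measurable _ (torus R)) P) =
    completion mut Pt /\
  forall (mu_ : borel X -> pprobability (borel X) R)
         (mut_ : torus R * borel X -> pprobability (torus R * borel X)%type R),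
    disintegration mu P mu_ ->
    disintegration mut Pt mut_ ->
    {ae mut, forall z, forall A : set (torus R * borel X), measurable A ->
       mut_ z A = (\d_(z.1) \x mu_ z.2)%E A}.
Proof.
move=> cX [cT T0 TD] Tmu _ P mut Theta Pt.
have mT w : measurable_fun setT (T w : borel X -> borel X) by exact: measurable_fun_borel.
(* [Theta] is convertible to [twist T 1 beta], so the facts on twists apply to it directly. *)
have PtE : Pt = zero_entropy mut Theta.
  exact: (PinskerE (measurable_twist mT 1 beta) (twist_preserving mT Tmu 1 beta)).
have sPt : sigma_algebra setT Pt.
  rewrite PtE.
  exact: (sigma_algebra_zero_entropy (measurable_twist mT 1 beta) (twist_preserving mT Tmu 1 beta)).
have sP : sigma_algebra setT P by exact: sigma_algebra_directional_Pinsker.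
have mP : P `<=` measurable by move=> A [].
have mPt : Pt `<=` measurable by move=> A [].
have PPt : product_sigma_algebra (@measurable _ (torus R)) P `<=` Pt.
  by rewrite PtE; exact: product_sub_zero_entropy.
have complE : completion mut (product_sigma_algebra (@measurable _ (torus R)) P) =
    completion mut Pt.
  apply/seteqP; split => A [B FB AB]; first by exists B => //; exact: PPt.
  have [|C PC BC] := zero_entropy_product_approx mT T0 TD Tmu (beta := beta) (E := B).
    by rewrite -PtE.
  exists C => //; apply: negligibleS (negligibleU AB BC); exact: setY_triangle.
split=> // mu_ mut_ dmu dmut.
have [G1 pG1] := countable_pi_generator_torus R.
have [G2 pG2] := countable_pi_generator_borel (compact_second_countable cX).
exact: (disintegration_product sP mP sPt mPt complE dmu dmut pG1 pG2).
Qed.
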